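(* Let $H\in\mathbb{R}^{d\times d}$ be symmetric positive semidefinite, $\rho>0$, $H_\rho=H+\rho I$, $\delta\in(0,1)$, and let $\epsilon>0$ be a user-defined tolerance. Let $\Omega\in\mathbb{R}^{d\times s}$ have i.i.d. standard Gaussian entries, and let $P$, with associated $\hat\lambda_s$, be the randomized Nyström preconditioner built from $\Omega$. Suppose \[ s\geq 8\left(\sqrt{d_{\mathrm{eff}}\!\left(\tfrac{\epsilon\rho}{6}\right)}+\sqrt{8\log(16/\delta)}\right)^{2}. \] Then \[ \frac{\hat\lambda_s+\rho}{\rho}\leq 1+\frac{\epsilon}{42}, \] and furthermore, with probability at least $1-\delta$, \[ \left|\kappa_2\big(P^{-1/2}H_\rho P^{-1/2}\big)-\frac{\hat\lambda_s+\rho}{\rho}\right|\leq\epsilon . \]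
   Context: For symmetric psd $H$ and $\sigma>0$, $d_{\mathrm{eff}}(\sigma)=\mathrm{tr}\big(H(H+\sigma I)^{-1}\big)$. The Nyström approximation is $H\langle\Omega\rangle=(H\Omega)(\Omega^{T}H\Omega)^{\dagger}(H\Omega)^{T}=U\hat\Lambda U^{T}$ with $U\in\mathbb{R}^{d\times s}$ having orthonormal columns and $\hat\Lambda=\mathrm{diag}(\hat\lambda_1\ge\dots\ge\hat\lambda_s)$, so $\hat\lambda_s$ is its $s$-th largest eigenvalue. The randomized Nyström preconditioner is $P=\frac{1}{\hat\lambda_s+\rho}U(\hat\Lambda+\rho I)U^{T}+(I-UU^{T})$. The quantity $(\hat\lambda_s+\rho)/\rho$ is called the empirical condition number. $\kappa_2$ is the spectral condition number. *)

(* Defs.v *)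
From HB Require Import structures.
From mathcomp Require Import all_boot all_order all_algebra.
From mathcomp Require Import all_classical all_reals all_analysis.
Set Implicit Arguments. Unset Strict Implicit. Unset Printing Implicit Defensive.
Import Order.TTheory GRing.Theory Num.Theory.
Import numFieldNormedType.Exports.
Local Open Scope classical_set_scope.
Local Open Scope ring_scope.

Section Defs.
Variable R : realType.

Definition psd {n : nat} (A : 'M[R]_n) : Prop :=
  A^T = A /\ forall x : 'cV[R]_n, 0 <= (x^T *m A *m x) 0 0.

Definition deff {n : nat} (H : 'M[R]_n) (sigma : R) : R :=
  \tr (H *m invmx (H + sigma%:M)).

(* Moore-Penrose pseudoinverse: the (unique) X satisfying the Penrose equations *)
Definition mp_pinv {m n : nat} (A : 'M[R]_(m, n)) : 'M[R]_(n, m) :=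
  xget 0 [set X : 'M[R]_(n, m) |
    [/\ A *m X *m A = A, X *m A *m X = X,
        (A *m X)^T = A *m X & (X *m A)^T = X *m A]].

Definition nystrom {d s : nat} (H : 'M[R]_d) (Om : 'M[R]_(d, s)) : 'M[R]_d :=
  (H *m Om) *m mp_pinv (Om^T *m H *m Om) *m (H *m Om)^T.

Definition nystrom_eig {d s : nat} (H : 'M[R]_d) (Om : 'M[R]_(d, s))
    (U : 'M[R]_(d, s)) (lam : 'rV[R]_s) : Prop :=
  [/\ U^T *m U = 1%:M,
      (forall i j : 'I_s, (i <= j)%N -> lam 0 j <= lam 0 i) &
      nystrom H Om = U *m diag_mx lam *m U^T].

(* hat lambda_s : the s-th (i.e. last) entry of lam *)
Definition lamhat_s {s : nat} (lam : 'rV[R]_s) : R :=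
  if @insub nat (fun k => (k < s)%N) 'I_s s.-1 is Some i then lam 0 i else 0.

Definition nystrom_precond {d s : nat} (U : 'M[R]_(d, s)) (lam : 'rV[R]_s)
    (rho : R) : 'M[R]_d :=
  (lamhat_s lam + rho)^-1 *: (U *m (diag_mx lam + rho%:M) *m U^T)
  + (1%:M - U *m U^T).

Definition enorm {n : nat} (x : 'cV[R]_n) : R := Num.sqrt (\sum_i x i 0 ^+ 2).

Definition opnorm {m n : nat} (A : 'M[R]_(m, n)) : R :=
  sup [set enorm (A *m x) | x in [set x : 'cV[R]_n | enorm x = 1]].

Definition kappa2 {n : nat} (A : 'M[R]_n) : R := opnorm A * opnorm (invmx A).

Definition sqrtm {n : nat} (A : 'M[R]_n) : 'M[R]_n :=
  xget 0 [set S : 'M[R]_n | psd S /\ S *m S = A].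

Definition inv_sqrtm {n : nat} (A : 'M[R]_n) : 'M[R]_n := sqrtm (invmx A).

Definition std_gaussian_matrix {dT : measure_display} {T : measurableType dT}
    (P : probability T R) {d s : nat} (Om : T -> 'M[R]_(d, s)) : Prop :=
  [/\ (forall i j, measurable_fun setT (fun w => Om w i j)),
      (forall i j (B : set R), measurable B ->
          P ((fun w => Om w i j) @^-1` B) = normal_prob 0 1 B) &
      (forall B : 'I_d -> 'I_s -> set R, (forall i j, measurable (B i j)) ->
          P (\bigcap_(ij in [set: 'I_d * 'I_s])
                ((fun w => Om w ij.1 ij.2) @^-1` B ij.1 ij.2))
          = (\prod_(ij : 'I_d * 'I_s) P ((fun w => Om w ij.1 ij.2) @^-1` B ij.1 ij.2))%E)].

End Defs.

(* Main.v *)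
Require Import Defs.
From HB Require Import structures.
From mathcomp Require Import all_boot all_order all_algebra.
From mathcomp Require Import all_classical all_reals all_analysis.
From mathcomp Require Import measurable_realfun ring lra.
Set Implicit Arguments. Unset Strict Implicit. Unset Printing Implicit Defensive.
Import Order.TTheory GRing.Theory Num.Theory.
Import numFieldNormedType.Exports.
Local Open Scope classical_set_scope.
Local Open Scope ring_scope.

(* With sigma = eps rho / 6 and K = H (H + sigma)^-1, so that deff = tr K:
   the eigenvectors of the Nystrom approximation, which lies between 0 and H,
   give deff >= s lam_s / (lam_s + sigma), hence lam_s <= sigma / 7 for every
   Omega.  If H - H<Omega> <= 6 sigma then rho P <= H_rho <= (lam_s + rho +
   eps rho) P, which gives the bound on kappa_2.

   If H - H<Omega> <= 6 sigma fails, some u = K z has Omega^T u = 0 and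
   z^T K z <= (7/6) |u|^2.  This is excluded by a PAC-Bayes argument: write
   K as a sum of b b^T over very short vectors b and put on \sum_b +-b the
   uniform prior over signs.  The prior mean W of
   exp(- th |Omega^T v|^2) (1 + 2 th |v|^2)^(s/2) has expectation 1, so
   W < 2 / delta with probability at least 1 - delta / 2.  Tilting the signs so
   that their mean becomes u, Jensen's inequality bounds W from below by
   exp(s ln 2 - th tr(Omega^T K Omega) - ...), which exceeds 2 / delta because
   tr(Omega^T K Omega) < s^2 / 8 outside an event of probability delta / 2, by
   a Chernoff bound. *)

(** * Inner products, psd forms and existence of the pseudoinverse *)

Section LinearAlgebra.
Variable R : realType.

Definition dot {n : nat} (x y : 'cV[R]_n) : R := (x^T *m y) 0 0.

Lemma dotE n (x y : 'cV[R]_n) : dot x y = \sum_i x i 0 * y i 0.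
Proof. by rewrite /dot mxE; apply: eq_bigr => i _; rewrite mxE. Qed.

Lemma dotC n (x y : 'cV[R]_n) : dot x y = dot y x.
Proof. by rewrite !dotE; apply: eq_bigr => i _; rewrite mulrC. Qed.

Lemma dotDr n (x y z : 'cV[R]_n) : dot x (y + z) = dot x y + dot x z.
Proof. by rewrite /dot mulmxDr mxE. Qed.

Lemma dotDl n (x y z : 'cV[R]_n) : dot (y + z) x = dot y x + dot z x.
Proof. by rewrite dotC dotDr !(dotC x). Qed.

Lemma dotZr n a (x y : 'cV[R]_n) : dot x (a *: y) = a * dot x y.
Proof. by rewrite /dot -scalemxAr mxE. Qed.

Lemma dotZl n a (x y : 'cV[R]_n) : dot (a *: x) y = a * dot x y.
Proof. by rewrite dotC dotZr dotC. Qed.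

Lemma dotNr n (x y : 'cV[R]_n) : dot x (- y) = - dot x y.
Proof. by rewrite -scaleN1r dotZr mulN1r. Qed.

Lemma dotNl n (x y : 'cV[R]_n) : dot (- x) y = - dot x y.
Proof. by rewrite dotC dotNr dotC. Qed.

Lemma dotBr n (x y z : 'cV[R]_n) : dot x (y - z) = dot x y - dot x z.
Proof. by rewrite dotDr dotNr. Qed.

Lemma dotBl n (x y z : 'cV[R]_n) : dot (y - z) x = dot y x - dot z x.
Proof. by rewrite dotDl dotNl. Qed.

Lemma dot0r n (x : 'cV[R]_n) : dot x 0 = 0.
Proof. by rewrite /dot mulmx0 mxE. Qed.

Lemma dot0l n (x : 'cV[R]_n) : dot 0 x = 0.
Proof. by rewrite dotC dot0r. Qed.

Lemma dot_mulmxr m n (A : 'M[R]_(m, n)) x y : dot x (A *m y) = dot (A^T *m x) y.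
Proof. by rewrite /dot trmx_mul trmxK mulmxA. Qed.

Lemma dotxx_ge0 n (x : 'cV[R]_n) : 0 <= dot x x.
Proof. by rewrite dotE; apply: sumr_ge0 => i _; rewrite -expr2 sqr_ge0. Qed.

Lemma dotxx_eq0 n (x : 'cV[R]_n) : dot x x = 0 -> x = 0.
Proof.
rewrite dotE => /eqP; rewrite psumr_eq0; last by move=> i _; rewrite -expr2 sqr_ge0.
move=> /allP h; apply/matrixP => i j; rewrite ord1 mxE.
by have := h i (mem_index_enum _); rewrite /= mulf_eq0 orbb => /eqP.
Qed.

Lemma sqr_enorm n (x : 'cV[R]_n) : enorm x ^+ 2 = dot x x.
Proof.
rewrite /enorm sqr_sqrtr; last by apply: sumr_ge0 => i _; rewrite sqr_ge0.
by rewrite dotE; apply: eq_bigr => i _; rewrite expr2.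
Qed.

Lemma enormE n (x : 'cV[R]_n) : enorm x = Num.sqrt (dot x x).
Proof. by rewrite -sqr_enorm sqrtr_sqr ger0_norm // sqrtr_ge0. Qed.

Lemma psd_dot n (A : 'M[R]_n) (x : 'cV[R]_n) : psd A -> 0 <= dot x (A *m x).
Proof. by move=> [_ /(_ x)]; rewrite -mulmxA. Qed.

Lemma psd_sym n (A : 'M[R]_n) : psd A -> A^T = A.
Proof. by case. Qed.

Lemma psdP n (A : 'M[R]_n) :
  A^T = A -> (forall x, 0 <= dot x (A *m x)) -> psd A.
Proof. by move=> As h; split=> // x; rewrite -mulmxA; exact: h. Qed.

Lemma sym_dot n (A : 'M[R]_n) x y : A^T = A -> dot x (A *m y) = dot (A *m x) y.
Proof. by move=> As; rewrite dot_mulmxr As. Qed.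

(** The form is nonnegative at a x - b y, where it equals a (c a - b^2). *)
Lemma psd_cauchy_schwarz n (A : 'M[R]_n) x y : psd A ->
  dot x (A *m y) ^+ 2 <= dot x (A *m x) * dot y (A *m y).
Proof.
move=> pA; have As := psd_sym pA.
set a := dot y (A *m y); set b := dot x (A *m y); set c := dot x (A *m x).
have q s t : dot (s *: x - t *: y) (A *m (s *: x - t *: y)) =
    s ^+ 2 * c - 2 * s * t * b + t ^+ 2 * a.
  rewrite mulmxBr -!scalemxAr !(dotBl, dotBr, dotZl, dotZr) -/a -/b -/c.
  by rewrite [dot y (A *m x)]sym_dot // dotC -/b; ring.
have a0 : 0 <= a by exact: psd_dot.
have c0 : 0 <= c by exact: psd_dot.
have [a_eq0|a_neq0] := eqVneq a 0.
  have [->|b0] := eqVneq b 0; first by rewrite expr0n mulr_ge0.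
  (* When a = 0 the form at x - t y is c - 2 t b; this t makes it -1, a contradiction. *)
  have := psd_dot (1 *: x - ((c + 1) / (2 * b)) *: y) pA.
  rewrite q a_eq0 mulr0 addr0 expr1n mul1r mulr1.
  have -> : 2 * ((c + 1) / (2 * b)) * b = c + 1 by field.
  lra.
have := psd_dot (a *: x - b *: y) pA; rewrite q.
have -> : a ^+ 2 * c - 2 * a * b * b + b ^+ 2 * a = a * (c * a - b ^+ 2) by ring.
by rewrite pmulr_rge0 ?lt_neqAle 1?eq_sym ?a_neq0 // subr_ge0.
Qed.

Lemma psd_scalar1 n : psd (1%:M : 'M[R]_n).
Proof. by apply: psdP => [|x]; rewrite ?tr_scalar_mx // mul1mx dotxx_ge0. Qed.

Lemma cauchy_schwarz n (x y : 'cV[R]_n) : dot x y ^+ 2 <= dot x x * dot y y.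
Proof. by have := psd_cauchy_schwarz x y (psd_scalar1 n); rewrite !mul1mx. Qed.

Lemma psd_dot_eq0 n (A : 'M[R]_n) x : psd A -> dot x (A *m x) = 0 -> A *m x = 0.
Proof.
move=> pA h; apply: dotxx_eq0; apply/eqP; rewrite -sqrf_eq0 eq_le sqr_ge0 andbT.
by have := psd_cauchy_schwarz (A *m x) x pA; rewrite h mulr0.
Qed.

Lemma mulmx_cV_inj m n (A B : 'M[R]_(m, n)) :
  (forall x : 'cV[R]_n, A *m x = B *m x) -> A = B.
Proof.
move=> h; apply/matrixP => i j.
by have /matrixP/(_ i 0) := h (delta_mx j 0); rewrite -!colE !mxE.
Qed.

Lemma posdef_unitmx n (A : 'M[R]_n) (c : R) : 0 < c ->
  (forall x, c * dot x x <= dot x (A *m x)) -> A \in unitmx.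
Proof.
move=> c0 h; rewrite -unitmx_tr -row_free_unit -kermx_eq0; apply/eqP/trmx_inj.
rewrite trmx0; apply: mulmx_cV_inj => x; rewrite mul0mx.
set y := _ *m x.
have Ay : A *m y = 0.
  by rewrite /y mulmxA -{1}[A]trmxK -trmx_mul mulmx_ker trmx0 mul0mx.
apply: dotxx_eq0; apply/eqP; rewrite eq_le dotxx_ge0 andbT.
by have := h y; rewrite Ay dot0r pmulr_rle0.
Qed.

Lemma row_free_gram_unitmx m n (F : 'M[R]_(m, n)) :
  row_free F -> F *m F^T \in unitmx.
Proof.
move=> fF; rewrite -row_free_unit -kermx_eq0; apply/eqP/trmx_inj.
rewrite trmx0; apply: mulmx_cV_inj => x; rewrite mul0mx.
set y := _ *m x.
have Ay : F *m F^T *m y = 0.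
  have -> : F *m F^T = (F *m F^T)^T by rewrite trmx_mul trmxK.
  by rewrite /y mulmxA -trmx_mul mulmx_ker trmx0 mul0mx.
have : F^T *m y = 0.
  by apply: dotxx_eq0; rewrite -dot_mulmxr mulmxA Ay dot0r.
move=> /(congr1 trmx); rewrite trmx_mul trmxK trmx0 => h.
by apply/trmx_inj/(row_free_inj fF); rewrite h trmx0 mul0mx.
Qed.

(** [xget] returns a Penrose inverse once one is known to exist. A full-rank factorisation A = C F
    supplies F^T (F F^T)^-1 (C^T C)^-1 C^T, both Gram matrices being invertible. *)
Lemma mp_pinvP m n (A : 'M[R]_(m, n)) : A *m mp_pinv A *m A = A.
Proof.
suff : exists X : 'M[R]_(n, m), [/\ A *m X *m A = A, X *m A *m X = X,
        (A *m X)^T = A *m X & (X *m A)^T = X *m A].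
  rewrite /mp_pinv => hX; set Q := [set X | _].
  by have [] : Q (xget 0 Q) by exact: xgetPex.
have [r [C [F [-> uF uC]]]] : exists r (C : 'M[R]_(m, r)) (F : 'M[R]_(r, n)),
    [/\ A = C *m F, F *m F^T \in unitmx & C^T *m C \in unitmx].
  exists (\rank A), (col_base A), (row_base A); split.
  - by rewrite mulmx_base.
  - by apply: row_free_gram_unitmx; exact: row_base_free.
  - rewrite -[X in _ *m X]trmxK; apply: row_free_gram_unitmx.
    rewrite -row_leq_rank mxrank_tr.
    by have := col_base_full A; rewrite /row_full => /eqP ->.
pose P := invmx (F *m F^T); pose Q := invmx (C^T *m C).
have Ps : P^T = P by rewrite /P trmx_inv trmx_mul trmxK.
have Qs : Q^T = Q by rewrite /Q trmx_inv trmx_mul trmxK.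
have FP : F *m F^T *m P = 1%:M by exact: mulmxV.
have PF : P *m (F *m F^T) = 1%:M by exact: mulVmx.
have QC : Q *m (C^T *m C) = 1%:M by exact: mulVmx.
exists (F^T *m P *m (Q *m C^T)).
have AX : C *m F *m (F^T *m P *m (Q *m C^T)) = C *m Q *m C^T.
  by rewrite !mulmxA -(mulmxA C F) -(mulmxA C) FP mulmx1.
have XA : F^T *m P *m (Q *m C^T) *m (C *m F) = F^T *m P *m F.
  by rewrite !mulmxA -(mulmxA _ Q) -(mulmxA _ (Q *m _)) -(mulmxA Q) QC mulmx1.
split.
- by rewrite AX !mulmxA -(mulmxA _ C^T) -(mulmxA C) QC mulmx1.
- by rewrite XA !mulmxA -(mulmxA _ F) -(mulmxA _ (F *m _)) FP mulmx1.
- by rewrite AX !trmx_mul trmxK Qs mulmxA.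
- by rewrite XA !trmx_mul trmxK Ps mulmxA.
Qed.

End LinearAlgebra.

(** * The Nystrom approximation, its eigenvalues and the effective dimension *)

Section Nystrom.
Variable R : realType.

(** The witness y = x - Om X Om^T H x is the part of x that is H-orthogonal to the range of [Om]. *)
Lemma nystrom_residual d s (H : 'M[R]_d) (Om : 'M[R]_(d, s)) x : psd H ->
  exists y, [/\ (H - nystrom H Om) *m x = H *m y, Om^T *m (H *m y) = 0 &
    dot x ((H - nystrom H Om) *m x) = dot y (H *m y)].
Proof.
move=> pH; have Hs := psd_sym pH.
set A := Om^T *m H *m Om; set X := mp_pinv A.
have AXA : A *m X *m A = A := mp_pinvP A.
set v := Om *m (X *m (Om^T *m (H *m x))); exists (x - v).
have E1 : (H - nystrom H Om) *m x = H *m (x - v).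
  by rewrite mulmxBl mulmxBr /nystrom -/A -/X trmx_mul Hs -!mulmxA.
(* M H M^T = (1 - A X) A (1 - A X)^T vanishes because A X A = A, and H kills every vector at which
   its form vanishes; hence M H = 0. *)
pose M := (1%:M - A *m X) *m Om^T.
have MH : M *m H = 0.
  apply: trmx_inj; rewrite trmx_mul Hs trmx0.
  apply: mulmx_cV_inj => z; rewrite mul0mx -mulmxA; apply: psd_dot_eq0 => //.
  rewrite -dot_mulmxr [X in dot z X](_ : _ = 0) ?dot0r // !mulmxA.
  have -> : M *m H *m M^T = (1%:M - A *m X) *m A *m (1%:M - A *m X)^T.
    by rewrite /M trmx_mul trmxK /A !mulmxA.
  by rewrite mulmxBl mul1mx AXA subrr !mul0mx.
have E2 : Om^T *m (H *m (x - v)) = 0.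
  have -> : Om^T *m (H *m (x - v)) = M *m H *m x.
    by rewrite /M /v /A !mulmxBr !mulmxBl mul1mx !mulmxA.
  by rewrite MH mul0mx.
split=> //.
have E3 : dot v (H *m (x - v)) = 0 by rewrite {1}/v dotC dot_mulmxr E2 dot0l.
by rewrite E1 [RHS]dotBl E3 subr0.
Qed.

Lemma nystrom_le d s (H : 'M[R]_d) (Om : 'M[R]_(d, s)) x : psd H ->
  dot x (nystrom H Om *m x) <= dot x (H *m x).
Proof.
move=> pH; have [y [_ _ h]] := nystrom_residual Om x pH.
by rewrite -subr_ge0 -dotBr -mulmxBl h psd_dot.
Qed.

(** With y the H-orthogonal remainder of x, the form of the approximation at x is the form of H at x
    - y. *)
Lemma nystrom_ge0 d s (H : 'M[R]_d) (Om : 'M[R]_(d, s)) x : psd H ->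
  0 <= dot x (nystrom H Om *m x).
Proof.
move=> pH; have [y [h1 _ h2]] := nystrom_residual Om x pH.
have Hs := psd_sym pH.
have e1 : nystrom H Om *m x = H *m (x - y).
  by rewrite mulmxBr -h1 mulmxBl opprB addrC subrK.
have e2 : dot x (H *m y) = dot y (H *m y) by rewrite -h2 h1.
suff -> : dot x (nystrom H Om *m x) = dot (x - y) (H *m (x - y)) by exact: psd_dot.
rewrite e1 mulmxBr !(dotBl, dotBr) e2 [dot y (H *m x)]sym_dot // [dot (H *m y) x]dotC e2.
ring.
Qed.

Lemma dot_diag s (D : 'rV[R]_s) (w : 'cV[R]_s) :
  dot w (diag_mx D *m w) = \sum_j D 0 j * w j 0 ^+ 2.
Proof.
by rewrite dotE; apply: eq_bigr => j _; rewrite mul_diag_mx mxE; ring.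
Qed.

Lemma dot_spectral d s (U : 'M[R]_(d, s)) D x :
  dot x (U *m diag_mx D *m U^T *m x) = \sum_j D 0 j * (U^T *m x) j 0 ^+ 2.
Proof. by rewrite -!mulmxA dot_mulmxr dot_diag. Qed.

Lemma mul_tr_col d s (U : 'M[R]_(d, s)) i x : (U^T *m x) i 0 = dot (col i U) x.
Proof. by rewrite dotE mxE; apply: eq_bigr => j _; rewrite !mxE. Qed.

Lemma orthonormal_dot d s (U : 'M[R]_(d, s)) i j : U^T *m U = 1%:M ->
  dot (col i U) (col j U) = (i == j)%:R.
Proof.
move=> /matrixP/(_ i j); rewrite mxE (mxE _ _ i j) => <-.
by rewrite dotE; apply: eq_bigr => k _; rewrite !mxE.
Qed.

Lemma bessel d s (U : 'M[R]_(d, s)) x : U^T *m U = 1%:M ->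
  dot (U^T *m x) (U^T *m x) <= dot x x.
Proof.
move=> hU; set w := U^T *m x; have := dotxx_ge0 (x - U *m w).
have e1 : dot x (U *m w) = dot w w by rewrite dot_mulmxr.
have e2 : dot (U *m w) (U *m w) = dot w w by rewrite dot_mulmxr mulmxA hU mul1mx.
by rewrite !(dotBl, dotBr) e2 (dotC _ x) e1; lra.
Qed.

Lemma lamhatP s (lam : 'rV[R]_s) : (0 < s)%N ->
  (forall i j : 'I_s, (i <= j)%N -> lam 0 j <= lam 0 i) ->
  exists i, lamhat_s lam = lam 0 i /\ forall j, lam 0 i <= lam 0 j.
Proof.
case: s lam => // s lam _ h; exists ord_max.
split; last by move=> j; apply: h; rewrite -ltnS.
rewrite /lamhat_s; case: insubP => [i _ iE|]; last by rewrite ltnSn.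
by have -> : i = ord_max by exact: val_inj.
Qed.

Lemma nystrom_eig_ge0 d s (H : 'M[R]_d) (Om U : 'M[R]_(d, s)) lam i : psd H ->
  nystrom_eig H Om U lam -> 0 <= lam 0 i.
Proof.
move=> pH [hU _ hN]; have := nystrom_ge0 Om (col i U) pH.
rewrite hN dot_spectral (bigD1 i) //= big1 => [|j ji].
  by rewrite mul_tr_col orthonormal_dot // eqxx expr1n mulr1 addr0.
by rewrite mul_tr_col orthonormal_dot // (negbTE ji) expr0n mulr0.
Qed.

Lemma rank_one_dot n (b x : 'cV[R]_n) : b *m b^T *m x = dot b x *: b.
Proof.
rewrite -mulmxA; apply/matrixP => i j; rewrite ord1 !mxE big_ord1 mulrC.
by rewrite /dot.
Qed.

(** Outer-product Cholesky factorisation, by induction on the number k of leading columns that may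
    be nonzero. Subtracting b b^T clears the last of them and leaves a Schur complement, psd by
    Cauchy-Schwarz. *)
Lemma psd_rank_one_sum n (A : 'M[R]_n) : psd A ->
  exists bs : seq 'cV[R]_n, A = \sum_(b <- bs) b *m b^T.
Proof.
suff h k : forall A : 'M[R]_n, psd A ->
    (forall i : 'I_n, (k <= i)%N -> A *m delta_mx i 0 = 0 :> 'cV_n) ->
    exists bs : seq 'cV[R]_n, A = \sum_(b <- bs) b *m b^T.
  by move=> pA; apply: (h n) => // i; rewrite leqNgt ltn_ord.
elim: k => [|k IH] {}A pA hA.
  exists [::]; rewrite big_nil; apply/matrixP => i j.
  by have /matrixP/(_ i 0) := hA j isT; rewrite -colE !mxE.
have As := psd_sym pA.
have [kn|] := ltnP k n; last first.
  by move=> nk; apply: IH => // i ki; have := ltn_ord i; rewrite ltnNge (leq_trans nk).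
pose e : 'cV[R]_n := delta_mx (Ordinal kn) 0.
have IHe : forall B : 'M[R]_n, psd B -> B *m e = 0 ->
    (forall i : 'I_n, (k < i)%N -> B *m delta_mx i 0 = 0 :> 'cV_n) ->
    exists bs : seq 'cV[R]_n, B = \sum_(b <- bs) b *m b^T.
  move=> B pB Be hB; apply: IH => // i; rewrite leq_eqVlt => /orP[/eqP ki|/hB //].
  by rewrite -Be /e; congr (_ *m delta_mx _ _); apply: val_inj.
have [Ae|Ae] := eqVneq (A *m e) 0; first exact: IHe.
set a := dot e (A *m e).
have a0 : 0 < a.
  rewrite lt_neqAle psd_dot // andbT eq_sym; apply/eqP => h.
  by move/eqP: Ae; apply; exact: psd_dot_eq0.
pose b := (Num.sqrt a)^-1 *: (A *m e).
have bx x : dot b x = (Num.sqrt a)^-1 * dot x (A *m e) by rewrite dotZl dotC.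
have ra : (Num.sqrt a)^-1 * (Num.sqrt a)^-1 = a^-1.
  by rewrite -invfM -expr2 sqr_sqrtr // ltW.
have [||i ki|bs hbs] := IHe (A - b *m b^T).
- apply: psdP => [|x]; first by rewrite linearB /= trmx_mul trmxK As.
  rewrite mulmxBl dotBr rank_one_dot dotZr [dot x b]dotC bx.
  rewrite mulrACA ra subr_ge0 mulrC ler_pdivrMr // -expr2.
  exact: psd_cauchy_schwarz.
- by rewrite mulmxBl rank_one_dot bx -/a scalerA mulrAC ra mulVf ?gt_eqF // scale1r subrr.
- by rewrite mulmxBl hA // rank_one_dot bx sym_dot // hA // dot0l mulr0 scale0r subrr.
by exists (b :: bs); rewrite big_cons -hbs addrC subrK.
Qed.

Lemma sum_rank_one_dot n (bs : seq 'cV[R]_n) x y :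
  dot x ((\sum_(b <- bs) b *m b^T) *m y) = \sum_(b <- bs) dot b x * dot b y.
Proof.
elim: bs => [|b bs IH]; first by rewrite !big_nil mul0mx dot0r.
by rewrite !big_cons mulmxDl dotDr IH rank_one_dot dotZr [dot x b]dotC mulrC.
Qed.

Lemma sum_rank_one_tr n (bs : seq 'cV[R]_n) :
  \tr (\sum_(b <- bs) b *m b^T) = \sum_(b <- bs) dot b b.
Proof.
elim: bs => [|b bs IH]; first by rewrite !big_nil mxtrace0.
rewrite !big_cons mxtraceD IH; congr (_ + _).
by rewrite mxtrace_mulC /mxtrace big_ord1 /dot.
Qed.

(** For a single term b b^T of [K] this is Bessel's inequality for b. *)
Lemma tr_compression_le d s (U : 'M[R]_(d, s)) (K : 'M[R]_d) :
  psd K -> U^T *m U = 1%:M ->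
  \sum_i dot (col i U) (K *m col i U) <= \tr K.
Proof.
move=> /psd_rank_one_sum [bs ->] hU; rewrite sum_rank_one_tr.
under eq_bigr do rewrite sum_rank_one_dot.
rewrite exchange_big /=; apply: ler_sum => b _.
apply: le_trans (bessel b hU); rewrite [leRHS]dotE.
by apply: ler_sum => i _; rewrite mul_tr_col dotC.
Qed.

Section Regularised.
Variables (d : nat) (H : 'M[R]_d) (sigma : R).
Hypotheses (pH : psd H) (sigma0 : 0 < sigma).

Lemma shift_dot x :
  dot x ((H + sigma%:M) *m x) = dot x (H *m x) + sigma * dot x x.
Proof. by rewrite mulmxDl dotDr mul_scalar_mx dotZr. Qed.

Lemma shift_unitmx : H + sigma%:M \in unitmx.
Proof.
apply: (posdef_unitmx sigma0) => x.
by rewrite shift_dot lerDr psd_dot.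
Qed.

Lemma shift_sym : (H + sigma%:M)^T = H + sigma%:M.
Proof. by rewrite linearD /= (psd_sym pH) tr_scalar_mx. Qed.

Lemma deff_mx_shift (y : 'cV[R]_d) :
  H *m invmx (H + sigma%:M) *m ((H + sigma%:M) *m y) = H *m y.
Proof. by rewrite -mulmxA mulKmx // shift_unitmx. Qed.

Lemma deff_mxE :
  H *m invmx (H + sigma%:M) = 1%:M - sigma *: invmx (H + sigma%:M).
Proof.
apply: (can_inj (mulmxK shift_unitmx)).
rewrite mulmxBl mul1mx -scalemxAl mulmxKV ?shift_unitmx // mulVmx ?shift_unitmx //.
by rewrite scalemx1 addrK.
Qed.

(** Substituting x = (H + sigma) y turns the form into |H y|^2 + sigma y^T H y. *)
Lemma psd_deff_mx : psd (H *m invmx (H + sigma%:M)).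
Proof.
apply: psdP => [|x].
  by rewrite deff_mxE linearB /= linearZ /= tr_scalar_mx trmx_inv shift_sym.
have -> : x = (H + sigma%:M) *m (invmx (H + sigma%:M) *m x).
  by rewrite mulKVmx // shift_unitmx.
rewrite deff_mx_shift; set y := invmx _ *m x.
rewrite mulmxDl mul_scalar_mx dotDl dotZl addr_ge0 ?dotxx_ge0 //.
by rewrite mulr_ge0 ?psd_dot // ltW.
Qed.

(** The trace of K dominates its compression to the columns u of [U], and u^T K u = 1 - sigma q with
    q = u^T y, y = (H + sigma)^-1 u. It remains to see (lam_i + sigma) q <= 1: q = y^T H y + sigma
    |y|^2, where y^T H y >= lam_i q^2 and |y|^2 >= q^2. *)
Lemma deff_ge_eig s (Om U : 'M[R]_(d, s)) lam i : nystrom_eig H Om U lam ->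
  (forall j, lam 0 i <= lam 0 j) ->
  s%:R * (lam 0 i / (lam 0 i + sigma)) <= deff H sigma.
Proof.
move=> hE hmin; have [hU _ hN] := hE.
have lam0 j : 0 <= lam 0 j := nystrom_eig_ge0 j pH hE.
have l0 : 0 < lam 0 i + sigma by rewrite ltr_wpDl.
apply: le_trans (tr_compression_le psd_deff_mx hU).
rewrite -[s in s%:R]card_ord mulr_natl -sumr_const; apply: ler_sum => j _.
set u := col j U; have uu : dot u u = 1 by rewrite orthonormal_dot // eqxx.
rewrite deff_mxE mulmxBl mul1mx dotBr uu -scalemxAl dotZr.
set y := invmx _ *m u; set q := dot u y.
have Ey : (H + sigma%:M) *m y = u by rewrite mulKVmx // shift_unitmx.
have hq : q = dot y (H *m y) + sigma * dot y y by rewrite -shift_dot Ey dotC.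
have h1 : q ^+ 2 <= dot y y by have := cauchy_schwarz u y; rewrite uu mul1r.
have h2 : lam 0 i * q ^+ 2 <= dot y (H *m y).
  apply: le_trans (nystrom_le Om y pH); rewrite hN dot_spectral (bigD1 j) //=.
  rewrite mul_tr_col -/u -/q ler_wpDr ?ler_wpM2r ?sqr_ge0 //.
  by apply: sumr_ge0 => k _; rewrite mulr_ge0 ?sqr_ge0.
have h3 : (lam 0 i + sigma) * q ^+ 2 <= q.
  by rewrite mulrDl [leRHS]hq lerD // ler_wpM2l // ltW.
rewrite ler_pdivrMr //.
have q0 : 0 <= q by apply: le_trans h3; rewrite mulr_ge0 ?sqr_ge0 // ltW.
suff h4 : (lam 0 i + sigma) * q <= 1 by have := ler_wpM2l (ltW sigma0) h4; lra.
have [->|qn0] := eqVneq q 0; first by rewrite mulr0.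
have qp : 0 < q by rewrite lt_neqAle eq_sym qn0.
by rewrite -(ler_pM2r qp) mul1r -mulrA -expr2.
Qed.

(** With 8 deff <= s the eigenvalue bound becomes 8 lam <= lam + sigma. *)
Lemma lamhat_le s (Om U : 'M[R]_(d, s)) lam : (0 < s)%N ->
  nystrom_eig H Om U lam -> 8 * deff H sigma <= s%:R ->
  lamhat_s lam <= sigma / 7.
Proof.
move=> s0 hE hs; have [_ hmono _] := hE.
have [i [-> hmin]] := lamhatP s0 hmono.
have h := deff_ge_eig hE hmin.
have l0 : 0 < lam 0 i + sigma by rewrite ltr_wpDl // (nystrom_eig_ge0 _ pH hE).
have sR : 0 < s%:R :> R by rewrite ltr0n.
have : s%:R * (8 * (lam 0 i / (lam 0 i + sigma))) <= s%:R * 1.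
  by rewrite mulr1 mulrCA; lra.
by rewrite ler_pM2l // mulrA ler_pdivrMr //; lra.
Qed.

End Regularised.
End Nystrom.

(** * Condition number of the preconditioned matrix *)

Section Condition.
Variable R : realType.

Lemma enorm_ge0 n (x : 'cV[R]_n) : 0 <= enorm x.
Proof. exact: sqrtr_ge0. Qed.

Lemma enorm1_dot n (x : 'cV[R]_n) : enorm x = 1 -> dot x x = 1.
Proof. by move=> h; rewrite -sqr_enorm h expr1n. Qed.

Lemma opnorm_le m n (A : 'M[R]_(m, n)) c : 0 <= c ->
  (forall x, enorm x = 1 -> enorm (A *m x) <= c) -> opnorm A <= c.
Proof.
move=> c0 h; rewrite /opnorm; set S := [set _ | _ in _].
(* Without unit vectors (n = 0) the supremum is that of the empty set, whose default value is 0. *)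
have [->|/set0P S0] := eqVneq S set0; first by rewrite sup0.
by apply: ge_sup => // _ [x hx <-]; exact: h.
Qed.

Lemma opnorm_ge m n (A : 'M[R]_(m, n)) c x :
  (forall x, enorm x = 1 -> enorm (A *m x) <= c) ->
  enorm x = 1 -> enorm (A *m x) <= opnorm A.
Proof.
move=> h hx; apply: ub_le_sup; last by exists x.
by exists c => _ [y hy <-]; exact: h.
Qed.

Lemma exists_unit_vector n : (0 < n)%N -> exists x : 'cV[R]_n, enorm x = 1.
Proof.
case: n => // n _; exists (delta_mx 0 0); rewrite enormE dotE (bigD1 0) //=.
rewrite big1 ?addr0 => [|i i0]; first by rewrite mxE eqxx mulr1 sqrtr1.
by rewrite mxE (negbTE i0) mul0r.
Qed.

(** Bounds on the form become bounds on norms. Cauchy-Schwarz for the form of M gives |M x|^4 <= c^2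
    |M x|^2; for y = M^-1 x, a |y|^2 <= y^T x <= |y|. The lower bound 1 comes from testing the
    inverse on the normalised M x0. *)
Lemma kappa2_bounds n (M : 'M[R]_n) a c : (0 < n)%N -> M^T = M -> 0 < a ->
  (forall x, a * dot x x <= dot x (M *m x)) ->
  (forall x, dot x (M *m x) <= c * dot x x) ->
  1 <= kappa2 M <= c / a.
Proof.
move=> n0 Ms a0 hlo hhi; have uM := posdef_unitmx a0 hlo.
have pM : psd M.
  by apply: psdP => // x; apply: le_trans (hlo x); rewrite mulr_ge0 ?dotxx_ge0 ?ltW.
have [x0 x01] := exists_unit_vector n0.
have c0 : 0 < c.
  have := le_trans (hlo x0) (hhi x0); rewrite enorm1_dot // !mulr1.
  exact: lt_le_trans.
have hM x : enorm x = 1 -> enorm (M *m x) <= c.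
  move=> x1; rewrite enormE -(ger0_norm (ltW c0)) -sqrtr_sqr; apply: ler_wsqrtr.
  set q := dot _ _; have q0 : 0 <= q by exact: dotxx_ge0.
  have h := psd_cauchy_schwarz (M *m x) x pM; rewrite -/q in h.
  have h1 : dot (M *m x) (M *m (M *m x)) * dot x (M *m x) <= c * q * c.
    apply: ler_pM; rewrite ?psd_dot ?hhi //.
    by have := hhi x; rewrite enorm1_dot // mulr1.
  have [->|qn0] := eqVneq q 0; first exact: sqr_ge0.
  have qp : 0 < q by rewrite lt_neqAle eq_sym qn0.
  by rewrite -(ler_pM2r qp) -expr2 (le_trans h) // (le_trans h1) //; lra.
have hV x : enorm x = 1 -> enorm (invmx M *m x) <= a^-1.
  move=> x1; set y := invmx M *m x.
  have My : M *m y = x by rewrite mulKVmx.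
  have av0 : 0 <= a^-1 by rewrite invr_ge0 ltW.
  rewrite -(ger0_norm av0) -sqrtr_sqr enormE; apply: ler_wsqrtr.
  set q := dot _ _; have q0 : 0 <= q by exact: dotxx_ge0.
  have h1 := hlo y; rewrite My -/q in h1.
  have h2 := cauchy_schwarz y x; rewrite (enorm1_dot x1) mulr1 -/q in h2.
  have h3 : (a * q) ^+ 2 <= q.
    by apply: le_trans h2; rewrite ler_sqr ?nnegrE // ?mulr_ge0 ?(ltW a0) //
      (le_trans _ h1) // mulr_ge0 // ltW.
  have [->|qn0] := eqVneq q 0; first exact: sqr_ge0.
  have qp : 0 < q by rewrite lt_neqAle eq_sym qn0.
  rewrite exprVn -[(a ^+ 2)^-1]mul1r ler_pdivlMr ?exprn_gt0 // -(ler_pM2r qp) mul1r.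
  by apply: le_trans h3; lra.
rewrite /kappa2; apply/andP; split; last first.
  have oM := opnorm_ge hM x01; have oV := opnorm_ge hV x01.
  apply: ler_pM; rewrite ?(le_trans (enorm_ge0 _) oM) ?(le_trans (enorm_ge0 _) oV) //.
    by apply: opnorm_le; rewrite ?ltW.
  by apply: opnorm_le; rewrite ?invr_ge0 ?ltW.
have e0 : 0 < enorm (M *m x0).
  rewrite lt_neqAle enorm_ge0 andbT eq_sym; apply/eqP => h.
  have /dotxx_eq0 h1 : dot (M *m x0) (M *m x0) = 0 by rewrite -sqr_enorm h expr0n.
  have := hlo x0; rewrite h1 dot0r enorm1_dot // mulr1.
  by rewrite leNgt a0.
pose y := (enorm (M *m x0))^-1 *: (M *m x0).
have enZ (z : 'cV[R]_n) : enorm ((enorm (M *m x0))^-1 *: z) = (enorm (M *m x0))^-1 * enorm z.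
  rewrite !enormE dotZl dotZr mulrA -expr2 sqrtrM ?sqr_ge0 // sqrtr_sqr -enormE.
  by rewrite ger0_norm // invr_ge0 ltW.
have y1 : enorm y = 1 by rewrite enZ mulVf // gt_eqF.
have := opnorm_ge hV y1; rewrite /y -scalemxAr mulKmx // enZ x01 mulr1 => h2.
have h1 := opnorm_ge hM x01.
by rewrite -(mulfV (lt0r_neq0 e0)) ler_pM // ?invr_ge0 ltW.
Qed.

(** For orthonormal [U] this acts as [D] on the range of [U] and as the identity on its complement.
    The preconditioner, its inverse and a root of the inverse all have this form, so their products
    reduce to entrywise products. *)
Definition spectral_shift d s (U : 'M[R]_(d, s)) (D : 'rV[R]_s) : 'M[R]_d :=
  U *m diag_mx D *m U^T + (1%:M - U *m U^T).

Section SpectralShift.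
Variables (d s : nat) (U : 'M[R]_(d, s)).
Hypothesis hU : U^T *m U = 1%:M.

Lemma spectral_shift_mul D D' :
  spectral_shift U D *m spectral_shift U D' =
  spectral_shift U (\row_j (D 0 j * D' 0 j)).
Proof.
rewrite /spectral_shift.
have UK p (A : 'M[R]_(s, p)) : U^T *m (U *m A) = A by rewrite mulmxA hU mul1mx.
have UP : U^T *m (1%:M - U *m U^T) = 0 by rewrite mulmxBr mulmx1 UK subrr.
have PU : (1%:M - U *m U^T) *m U = 0 by rewrite mulmxBl mul1mx -mulmxA hU mulmx1 subrr.
have PP : (1%:M - U *m U^T) *m (1%:M - U *m U^T) = 1%:M - U *m U^T.
  by rewrite mulmxBr mulmx1 mulmxA PU mul0mx subr0.
move: (1%:M - _) UP PU PP => Q UP PU PP.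
rewrite mulmxDl !mulmxDr PP -[_ *m U^T *m Q]mulmxA UP mulmx0 addr0.
rewrite 2!(mulmxA Q) PU !mul0mx add0r; congr (_ + _).
by rewrite -!mulmxA UK !mulmxA -(mulmxA U) mulmx_diag.
Qed.

Lemma spectral_shift1 : spectral_shift U (const_mx 1) = 1%:M.
Proof. by rewrite /spectral_shift diag_const_mx mulmx1 addrC subrK. Qed.

Lemma spectral_shift_dot D x : dot x (spectral_shift U D *m x) =
  \sum_j D 0 j * (U^T *m x) j 0 ^+ 2 + (dot x x - dot (U^T *m x) (U^T *m x)).
Proof.
rewrite /spectral_shift mulmxDl dotDr dot_spectral mulmxBl mul1mx dotBr.
by rewrite -[U *m U^T *m x]mulmxA [dot x (U *m _)]dot_mulmxr.
Qed.

Lemma spectral_shift_psd (D : 'rV[R]_s) : (forall j, 0 <= D 0 j) -> psd (spectral_shift U D).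
Proof.
move=> D0; apply: psdP => [|x].
  by rewrite linearD /= linearB /= !trmx_mul !trmxK tr_diag_mx tr_scalar_mx mulmxA.
rewrite spectral_shift_dot addr_ge0 ?subr_ge0 ?bessel //.
by apply: sumr_ge0 => j _; rewrite mulr_ge0 ?sqr_ge0.
Qed.

Lemma spectral_shift_inv (D : 'rV[R]_s) : (forall j, 0 < D 0 j) ->
  spectral_shift U (\row_j (D 0 j)^-1) *m spectral_shift U D = 1%:M.
Proof.
move=> D0; rewrite spectral_shift_mul -spectral_shift1; congr spectral_shift.
by apply/matrixP => i j; rewrite !mxE mulVf // gt_eqF.
Qed.

(** Both conclusions hold for whichever psd root of the inverse [sqrtm] selects, so it is enough to
    exhibit one, with entries sqrt (D_j^-1). *)
Lemma inv_sqrtmP (D : 'rV[R]_s) : (forall j, 0 < D 0 j) ->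
  let S := inv_sqrtm (spectral_shift U D) in
  S^T = S /\ S *m spectral_shift U D *m S = 1%:M.
Proof.
move=> D0; rewrite /inv_sqrtm /sqrtm; set P := spectral_shift U D.
set Q := [set S | _].
have hP := spectral_shift_inv D0.
have uP : P \in unitmx by case: (mulmx1_unit hP).
have [pS hS] : Q (xget 0 Q).
  apply: xgetPex; exists (spectral_shift U (\row_j Num.sqrt (D 0 j)^-1)); split.
    by apply: spectral_shift_psd => j; rewrite mxE sqrtr_ge0.
  apply: (can_inj (mulmxK uP)); rewrite mulVmx // spectral_shift_mul -[RHS]hP.
  congr (spectral_shift _ _ *m _); apply/matrixP => i j.
  by rewrite !mxE -expr2 sqr_sqrtr // invr_ge0 ltW.
split; first exact: psd_sym pS.
by apply: mulmx1C; rewrite mulmxA hS mulVmx.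
Qed.

End SpectralShift.

Lemma nystrom_precondE d s (U : 'M[R]_(d, s)) lam rho :
  nystrom_precond U lam rho =
  spectral_shift U (\row_j ((lam 0 j + rho) / (lamhat_s lam + rho))).
Proof.
rewrite /nystrom_precond /spectral_shift; congr (_ + _).
rewrite scalemxAl scalemxAr; congr (_ *m _ *m _); apply/matrixP => i j.
by rewrite !mxE; case: eqP => [->|_]; rewrite ?mulr1n ?mulr0n ?addr0 ?mulr0 // mulrC.
Qed.

Lemma kappa2_precond d s (H : 'M[R]_d) (Om U : 'M[R]_(d, s)) lam rho eta :
  psd H -> 0 < rho -> 0 <= eta -> (0 < s)%N -> (s <= d)%N ->
  nystrom_eig H Om U lam ->
  (forall x, dot x ((H - nystrom H Om) *m x) <= eta * dot x x) ->
  let S := inv_sqrtm (nystrom_precond U lam rho) in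
  1 <= kappa2 (S *m (H + rho%:M) *m S) <= (lamhat_s lam + rho + eta) / rho.
Proof.
move=> pH rho0 eta0 s0 sd hE hx; have [hU hmono hN] := hE.
have [i [lsE hmin]] := lamhatP s0 hmono.
have lam0 j : 0 <= lam 0 j := nystrom_eig_ge0 j pH hE.
rewrite nystrom_precondE; set D := \row_j _; set ls := lamhat_s lam in D lsE *.
have ls0 : 0 <= ls by rewrite lsE.
have lsr : 0 < ls + rho by rewrite ltr_wpDl.
have DE j : D 0 j = (lam 0 j + rho) / (ls + rho) by rewrite mxE.
have D1 j : 1 <= D 0 j.
  by rewrite DE ler_pdivlMr // mul1r lerD2r lsE.
have D0 j : 0 < D 0 j by apply: lt_le_trans (D1 j).
have [Ss SPS] := inv_sqrtmP hU D0; set S := inv_sqrtm _ in Ss SPS *.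
move=> /=; set P := spectral_shift U D in SPS *.
have toP x : dot x x = dot (S *m x) (P *m (S *m x)).
  by rewrite -[RHS]sym_dot // !mulmxA SPS mul1mx.
have toH x : dot x (S *m (H + rho%:M) *m S *m x) =
    dot (S *m x) ((H + rho%:M) *m (S *m x)) by rewrite -[RHS]sym_dot // !mulmxA.
have wE y : dot (U^T *m y) (U^T *m y) = \sum_j (U^T *m y) j 0 ^+ 2.
  by rewrite dotE; under eq_bigr do rewrite -expr2.
(* On the range of [U] the preconditioner is the shifted approximation divided by ls + rho; this
   trades its form for that of [nystrom]. *)
have NE y : (ls + rho) * \sum_j D 0 j * (U^T *m y) j 0 ^+ 2 =
    dot y (nystrom H Om *m y) + rho * dot (U^T *m y) (U^T *m y).
  rewrite hN dot_spectral wE !mulr_sumr -big_split /=; apply: eq_bigr => j _.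
  by rewrite DE; field; rewrite gt_eqF.
have D1s y : dot (U^T *m y) (U^T *m y) <= \sum_j D 0 j * (U^T *m y) j 0 ^+ 2.
  by rewrite wE; apply: ler_sum => j _; rewrite ler_peMl ?sqr_ge0.
have Py y : dot y (P *m y) = \sum_j D 0 j * (U^T *m y) j 0 ^+ 2 +
    (dot y y - dot (U^T *m y) (U^T *m y)) by exact: spectral_shift_dot.
apply: kappa2_bounds => //.
- exact: leq_trans sd.
- by rewrite !trmx_mul Ss (shift_sym rho pH) mulmxA.
- move=> x; rewrite toP toH; set y := S *m x.
  rewrite shift_dot Py; have h1 := nystrom_le Om y pH; have h2 := NE y.
  have h3 := D1s y; have h4 := bessel y hU; have h5 := dotxx_ge0 (U^T *m y).
  set a := \sum_j _ in h2 h3 *; set w := dot (U^T *m y) _ in h2 h3 h4 h5 *.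
  set N := dot y (nystrom _ _ *m y) in h1 h2.
  (* The gap in the lower bound is h - N + ls a. *)
  have : 0 <= ls * a by rewrite mulr_ge0 // (le_trans h5).
  by move: (dot y (H *m y)) (dot y y) h1 h4 => h yy h1 h4; lra.
- move=> x; rewrite toP toH; set y := S *m x.
  rewrite shift_dot Py; have h2 := NE y; have := hx y; rewrite mulmxBl dotBr => h1.
  have h3 := D1s y; have h4 := bessel y hU; have h5 := dotxx_ge0 (U^T *m y).
  set a := \sum_j _ in h2 h3 *; set w := dot (U^T *m y) _ in h2 h3 h4 h5 *.
  set N := dot y (nystrom _ _ *m y) in h1 h2.
  move: (dot y (H *m y)) (dot y y) h1 h4 => h yy h1 h4.
  (* The gap in the upper bound is at least ls (yy - w) + eta (a - w). *)
  have e1 : 0 <= ls * (yy - w) by rewrite mulr_ge0 // subr_ge0.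
  have e2 : 0 <= eta * (a - w) by rewrite mulr_ge0 // subr_ge0.
  lra.
Qed.

End Condition.

(** * Independence from a sigma-algebra and Fubini *)

Section Independence.
Context d (T : measurableType d) (R : realType).
Variables (P : probability T R) (N : probability (measurableTypeR R) R).
Variables (G : set (set T)) (X : T -> R).
Hypotheses (mG : G `<=` measurable) (GI : setI_closed G) (GT : G setT).
Hypothesis mX : measurable_fun setT X.
Hypothesis indep : forall A B, G A -> measurable B ->
  P (A `&` X @^-1` B) = (P A * N B)%E.

Let TG : measurableType _ := g_sigma_algebraType G.
Let TR : measurableType _ := measurableTypeR R.

Lemma g_sigma_algebra_measurable (A : set TG) :
  measurable A -> measurable (A : set T).
Proof. exact: (smallest_sub (@sigma_algebra_measurable _ T) mG). Qed.

(** As functions of A both sides are finite measures that agree on the pi-system [G]. *)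
Lemma indep_sigma A B : <<s G >> A -> measurable B ->
  P (A `&` X @^-1` B) = (P A * N B)%E.
Proof.
move=> sA mB.
have mXB : measurable (X @^-1` B) by rewrite -[X @^-1` B]setTI; exact: mX.
have NB : (N B \is a fin_num) := fin_num_measure N B mB.
have NB0 : 0 <= fine (N B) by rewrite fine_ge0.
have := @g_sigma_algebra_measure_unique _ R T G mG (fun=> setT) (fun=> GT) _
  (mrestr P mXB) (mscale (NngNum NB0) P) GI _ _ _ sA.
rewrite /= /mrestr /mscale /= fineK // => -> //; first by rewrite muleC.
- by rewrite bigcup_const.
- by move=> C GC; rewrite indep // muleC.
- by move=> _; rewrite setTI (le_lt_trans (probability_le1 P mXB)) // ltry.
Qed.

(* Fubini for the joint law of the sigma-algebra generated by [G] and [X]. *)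
Lemma integral_indep (f : (TG * TR)%type -> \bar R) :
  measurable_fun setT f -> (forall z, 0 <= f z)%E ->
  (\int[P]_w f (w, X w) = \int[P]_w \int[N]_x f (w, x))%E.
Proof.
move=> mf f0.
have mid : measurable_fun setT (id : T -> TG).
  by move=> _ Y mY; rewrite setTI; exact: g_sigma_algebra_measurable.
have mPhi : measurable_fun setT (fun w : T => (w : TG, X w : TR)).
  exact: measurable_fun_pair.
pose idm : {mfun T >-> TG} := HB.pack (id : T -> TG)
  (isMeasurableFun.Build _ _ _ _ _ mid).
pose Phi : {mfun T >-> (TG * TR)%type} :=
  HB.pack (fun w : T => (w : TG, X w : TR))
  (isMeasurableFun.Build _ _ _ _ _ mPhi).
pose m1 : probability TG R := distribution P idm.
pose m' : probability (TG * TR)%type R := distribution P Phi.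
(* The joint law of the identity and [X] is a product, since the two measures agree on
   rectangles. *)
have E A : measurable A -> (m1 \x N)%E A = m' A.
  move=> mA; apply: product_measure_unique => // {mA}A B mA mB.
  exact: indep_sigma.
transitivity (\int[m']_z f z)%E.
  by rewrite [RHS]ge0_integral_pushforward.
rewrite (eq_measure_integral (m1 \x N)%E); last by move=> A mA _; exact/esym/E.
rewrite fubini_tonelli1 // [LHS]ge0_integral_pushforward //.
  exact: measurable_fun_fubini_tonelli_F.
by move=> w _; apply: integral_ge0 => x _.
Qed.

End Independence.

(** * One-dimensional Gaussian integrals *)

Section GaussianIntegral.
Variable R : realType.
Notation mu := (@lebesgue_measure R).

(** The Radon-Nikodym derivative of the normal law equals [normal_pdf] almost everywhere, both
    having the same integral over every measurable set. *)
Lemma integral_normal_prob (m sigma : R) (f : R -> \bar R) : 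
  measurable_fun setT f -> (forall x, 0 <= f x)%E ->
  (\int[normal_prob m sigma]_x f x =
   \int[mu]_x (f x * (normal_pdf m sigma x)%:E))%E.
Proof.
move=> mf f0; have dom := normal_prob_dominates m sigma.
rewrite -(Radon_Nikodym_SigmaFinite.change_of_variables dom) //.
set g := Radon_Nikodym_SigmaFinite.f _ _.
have ig : mu.-integrable setT g := Radon_Nikodym_SigmaFinite.f_integrable dom.
have mpdf : measurable_fun setT (EFin \o normal_pdf m sigma).
  by apply/measurable_EFinP; exact: measurable_normal_pdf.
have ae : ae_eq mu setT g (EFin \o normal_pdf m sigma).
  apply: (integral_ae_eq measurableT ig mpdf) => E _ mE.
  by rewrite -Radon_Nikodym_SigmaFinite.f_integral.
apply: ge0_ae_eq_integral => //.
- by apply: emeasurable_funM => //; exact: measurable_int ig.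
- exact: emeasurable_funM.
- by move=> x _; rewrite mule_ge0 // Radon_Nikodym_SigmaFinite.f_ge0.
- by move=> x _; rewrite mule_ge0 // lee_fin normal_pdf_ge0.
- by apply: filterS ae => x /= h /h ->.
Qed.

(** Completing the square: the integrand is a constant k times the normal density of mean m and
    variance 1 / p. Negative [th] with p > 0 is covered; the Chernoff bound relies on it. *)
Lemma gaussian_integral (th c y : R) : 0 < 1 + 2 * th * c ^+ 2 ->
  (\int[normal_prob 0 1]_x (expR (- th * (y + c * x) ^+ 2))%:E =
   ((Num.sqrt (1 + 2 * th * c ^+ 2))^-1 *
    expR (- (th / (1 + 2 * th * c ^+ 2)) * y ^+ 2))%:E)%E.
Proof.
set p := 1 + _ => p0.
have mexp : measurable_fun setT (fun x : R => (expR (- th * (y + c * x) ^+ 2))%:E).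
  apply/measurable_EFinP; apply: measurableT_comp => //.
  apply: measurable_funM => //; apply: measurable_funX.
  by apply: measurable_funD => //; exact: measurable_funM.
rewrite integral_normal_prob //.
pose sg := (Num.sqrt p)^-1; pose m := - (2 * th * c * y) / p.
have sp0 : 0 < Num.sqrt p by rewrite sqrtr_gt0.
have sg0 : sg != 0 by rewrite invr_eq0 gt_eqF.
have sg2 : sg ^+ 2 = p^-1 by rewrite exprVn sqr_sqrtr // ltW.
pose k := (Num.sqrt p)^-1 * expR (- (th / p) * y ^+ 2).
have k0 : 0 <= k by rewrite mulr_ge0 ?expR_ge0 // invr_ge0 sqrtr_ge0.
have E x : ((expR (- th * (y + c * x) ^+ 2))%:E * (normal_pdf 0 1 x)%:E =
    k%:E * (normal_pdf m sg x)%:E)%E.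
  rewrite -!EFinM; congr _%:E; rewrite !normal_pdfE ?oner_eq0 //.
  have -> : normal_peak 1 = (Num.sqrt p)^-1 * normal_peak sg.
    rewrite /normal_peak sg2 expr1n mul1r -mulrnAr sqrtrM ?invr_ge0 ?ltW //.
    by rewrite invfM sqrtrV ?ltW // invrK mulKf // gt_eqF.
  rewrite /k /normal_fun.
  set q := normal_peak sg; set r := (Num.sqrt p)^-1.
  rewrite mulrCA -!mulrA; congr (r * _); rewrite [RHS]mulrCA; congr (q * _).
  rewrite -!expRD; congr expR; rewrite sg2 /m subr0 expr1n.
  have pE : p = 1 + 2 * th * c ^+ 2 by [].
  have pn0 : p != 0 by rewrite gt_eqF.
  apply: (mulIf pn0); rewrite [LHS]mulrDl [RHS]mulrDl.
  have -> : - (x - - (2 * th * c * y) / p) ^+ 2 / (p^-1 *+ 2) * p =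
      - (p * x + 2 * th * c * y) ^+ 2 / 2 by rewrite -mulr_natr; field.
  have -> : - (th / p) * y ^+ 2 * p = - th * y ^+ 2 by field.
  by rewrite -[1 *+ 2]/(1 + 1) pE; field.
under eq_integral do rewrite E.
rewrite ge0_integralZl //.
- by rewrite integral_normal_pdf mule1.
- by apply/measurable_EFinP; exact: measurable_normal_pdf.
- by move=> x _; rewrite lee_fin normal_pdf_ge0.
Qed.

End GaussianIntegral.

(** * Moment generating functions of Gaussian families and matrices *)

Lemma measurable_prod_gauss dT (T : measurableType dT) (R : realType) s
    (th : 'I_s -> R) (Y : 'I_s -> T -> R) :
  (forall j, measurable_fun setT (Y j)) ->
  measurable_fun setT (fun w => \prod_j expR (- th j * Y j w ^+ 2)).
Proof.
move=> mY; apply: measurable_prod => j _; apply: measurableT_comp => //.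
by apply: measurable_funM => //; exact: measurable_funX.
Qed.

Section GaussianFamily.
Context dT (T : measurableType dT) (R : realType) (P : probability T R).
Variables (I : finType) (X : I -> T -> R).
Hypothesis mX : forall i, measurable_fun setT (X i).
Hypothesis iidX : forall B : I -> set R, (forall i, measurable (B i)) ->
  P (\bigcap_(i in [set: I]) (X i @^-1` B i)) =
  (\prod_i normal_prob 0 1 (B i))%E.

(** A pi-system generating the sigma-algebra of the variables in [l]. Constraints are trivial off
    [l], yet the intersection runs over all of [I] to match [iidX]. *)
Definition cylinder (l : seq I) : set (set T) :=
  [set A | exists B : I -> set R, [/\ forall i, measurable (B i),
    forall i, i \notin l -> B i = setT &
    A = \bigcap_(i in [set: I]) (X i @^-1` B i)]].

Lemma cylinder_measurable l : cylinder l `<=` measurable.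
Proof.
move=> _ [B [mB _ ->]]; apply: fin_bigcap_measurable => // i _.
by rewrite -[X in measurable X]setTI; exact: mX.
Qed.

Lemma cylinderI l : setI_closed (cylinder l).
Proof.
move=> _ _ [B [mB B1 ->]] [C [mC C1 ->]]; exists (fun i => B i `&` C i); split.
- by move=> i; exact: measurableI.
- by move=> i il; rewrite B1 // C1 // setTI.
- by rewrite -bigcapI.
Qed.

Lemma cylinderT l : cylinder l setT.
Proof.
exists (fun=> setT); split=> //.
by apply/esym; rewrite -subTset => w _ i _.
Qed.

(** As k is not in [l], B can replace the trivial constraint at k, which leaves a single box covered
    by [iidX]. *)
Lemma cylinder_indep l k A B : k \notin l -> cylinder l A -> measurable B ->
  P (A `&` X k @^-1` B) = (P A * normal_prob 0 1 B)%E.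
Proof.
move=> kl [C [mC C1 ->]] mB.
pose C' i := if i == k then B else C i.
have mC' i : measurable (C' i) by rewrite /C'; case: ifP.
have -> : \bigcap_(i in [set: I]) (X i @^-1` C i) `&` X k @^-1` B =
    \bigcap_(i in [set: I]) (X i @^-1` C' i).
  apply/seteqP; split=> [w [h1 h2] i _|w h]; rewrite /C' /=.
    by case: eqP => [->|_] //; exact: h1.
  split=> [i _|]; last by have := h k Logic.I; rewrite /C' /= eqxx.
  have := h i Logic.I; rewrite /C' /=; case: eqP => [->|//] _.
  by rewrite C1.
rewrite !iidX // (bigD1 k) //= [in RHS](bigD1 k) //= C1 // probability_setT mul1e.
rewrite {1}/C' eqxx muleC; congr (_ * _)%E; apply: eq_bigr => i ik.
by rewrite /C' (negbTE ik).
Qed.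

Lemma measurable_cylinder_var l i : i \in l ->
  measurable_fun setT (X i : g_sigma_algebraType (cylinder l) -> R).
Proof.
move=> il _ B mB; rewrite setTI; apply: sub_sigma_algebra.
exists (fun j => if j == i then B else setT); split.
- by move=> j; case: ifP.
- by move=> j jl; case: eqP => // ji; rewrite ji il in jl.
- apply/seteqP; split=> [w h j _|w /(_ i Logic.I)] /=.
    by case: eqP => [->|].
  by rewrite eqxx.
Qed.

(** Variables are integrated out one at a time. Variable k enters only the factor [col k], and
    integrating it turns th_j into th_j / p_j; [th] depends on j so that the induction closes. *)
Lemma gaussian_family_integral s (a : 'I_s -> I -> R) (col : I -> 'I_s) l
    (th : 'I_s -> R) :
  (forall j i, j != col i -> a j i = 0) -> uniq l ->
  (forall j, 0 < 1 + 2 * th j * \sum_(i <- l) a j i ^+ 2) ->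
  (\int[P]_w (\prod_j expR (- th j * (\sum_(i <- l) a j i * X i w) ^+ 2))%:E =
   (\prod_j (Num.sqrt (1 + 2 * th j * \sum_(i <- l) a j i ^+ 2))^-1)%:E)%E.
Proof.
move=> acol; elim: l th => [|k l IH] th.
  move=> _ _; under eq_integral.
    move=> w _; rewrite big1 => [|j _]; last by rewrite big_nil expr0n mulr0 expR0.
    over.
  rewrite integral_cst // mul1e.
  transitivity (1%:E : \bar R); first exact: probability_setT.
  rewrite big1 // => j _.
  by rewrite big_nil mulr0 addr0 sqrtr1 invr1.
rewrite /= => /andP[kl ul] hth.
pose p j := 1 + 2 * th j * a j k ^+ 2.
pose S j := \sum_(i <- l) a j i ^+ 2.
have S0 j : 0 <= S j by apply: sumr_ge0 => i _; exact: sqr_ge0.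
(* For negative th_j, p_j is at least the full expression, positive by hypothesis. *)
have p0 j : 0 < p j.
  have := hth j; rewrite big_cons -/(S j) /p => h.
  have [t0|t0] := leP 0 (th j).
    by rewrite ltr_pwDl // mulr_ge0 ?sqr_ge0 // mulr_ge0.
  apply: lt_le_trans h _; rewrite lerD2l.
  by rewrite ler_wnM2l // ?lerDl ?S0 // nmulr_lle0 // ltW.
pose Y j w := \sum_(i <- l) a j i * X i w.
pose TG : measurableType _ := g_sigma_algebraType (cylinder l).
pose f (z : (TG * measurableTypeR R)%type) :=
  (\prod_j expR (- th j * (Y j z.1 + a j k * z.2) ^+ 2))%:E.
have mY j : measurable_fun setT (Y j : TG -> R).
  (* Only variables of [l] are measurable for the cylinder sigma-algebra, so summands are set to 0
     off [l] before arguing termwise. *)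
  have -> : Y j = fun w => \sum_(i <- l) a j i * (if i \in l then X i w else 0).
    by apply/funext => w; apply: eq_big_seq => i ->.
  apply: measurable_sum => i; apply: measurable_funM => //.
  by case: (boolP (i \in l)) => // il; exact: measurable_cylinder_var.
have mf : measurable_fun setT f.
  apply/measurable_EFinP; apply: measurable_prod_gauss => j.
  apply: measurable_funD; first exact: measurableT_comp.
  by apply: measurable_funM => //; exact: measurable_snd.
transitivity (\int[P]_w f (w, X k w))%E.
  apply: eq_integral => w _; congr _%:E; apply: eq_bigr => j _.
  by rewrite big_cons addrC.
rewrite (@integral_indep _ T R P (normal_prob 0 1) (cylinder l)) //; last first.
- by move=> z; rewrite lee_fin prodr_ge0 // => j _; exact: expR_ge0.
- by move=> A B cA mB; exact: cylinder_indep cA mB.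
- exact: cylinderT.
- exact: cylinderI.
- exact: cylinder_measurable.
pose th' j := th j / p j.
pose r := \prod_j (Num.sqrt (p j))^-1.
have r0 : 0 <= r by apply: prodr_ge0 => j _; rewrite invr_ge0 sqrtr_ge0.
have E w : (\int[normal_prob 0 1]_x f (w, x) =
    r%:E * (\prod_j expR (- th' j * Y j w ^+ 2))%:E)%E.
  pose q := \prod_(j | j != col k) expR (- th j * Y j w ^+ 2).
  have fE x : f (w, x) =
      (q%:E * (expR (- th (col k) * (Y (col k) w + a (col k) k * x) ^+ 2))%:E)%E.
    rewrite /f (bigD1 (col k)) //= mulrC EFinM; congr (_%:E * _)%E.
    by apply: eq_bigr => j jk; rewrite acol // mul0r addr0.
  under eq_integral do rewrite fE.
  rewrite ge0_integralZl //; last 2 first.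
  - apply/measurable_EFinP; apply: measurableT_comp => //.
    apply: measurable_funM => //; apply: measurable_funX.
    by apply: measurable_funD => //; exact: measurable_funM.
  - by rewrite lee_fin prodr_ge0 // => j _; exact: expR_ge0.
  rewrite gaussian_integral; last exact: p0.
  rewrite -!EFinM; congr _%:E.
  have -> : r = (Num.sqrt (p (col k)))^-1.
    rewrite /r (bigD1 (col k)) //= big1 ?mulr1 // => j jk.
    by rewrite /p acol // expr0n mulr0 addr0 sqrtr1 invr1.
  rewrite [in RHS](bigD1 (col k)) //= -/(p (col k)) -/(th' (col k)).
  rewrite mulrC -mulrA; congr (_ * (_ * _)).
  by apply: eq_bigr => j jk; rewrite /th' /p acol // expr0n mulr0 addr0 divr1.
(* The normalising factors before and after integrating out k multiply to the one for k :: l. *)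
have pE j : p j * (1 + 2 * th' j * S j) =
    1 + 2 * th j * \sum_(i <- k :: l) a j i ^+ 2.
  have -> : p j * (1 + 2 * th' j * S j) = p j + 2 * (p j * th' j) * S j by ring.
  have -> : p j * th' j = th j by rewrite /th' mulrC divfK ?gt_eqF.
  by rewrite big_cons -/(S j) /p; ring.
under eq_integral do rewrite E.
rewrite ge0_integralZl //.
- rewrite IH // => [|j]; last by rewrite -(pmulr_rgt0 _ (p0 j)) pE.
  rewrite -EFinM /r -big_split /=; congr _%:E; apply: eq_bigr => j _.
  by rewrite -pE sqrtrM ?ltW // invfM.
- apply/measurable_EFinP; apply: measurable_prod_gauss => j.
  by apply: measurable_sum => i; exact: measurable_funM.
- by move=> w _; rewrite lee_fin prodr_ge0 // => j _; exact: expR_ge0.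
Qed.

End GaussianFamily.

(** Entries are indexed by pairs, and entry (i, k) enters only coordinate k of Om^T u, with
    coefficient u_i. *)
Lemma gaussian_matrix_mgf (dT : measure_display) (T : measurableType dT)
    (R : realType) (P : probability T R) d s (Om : T -> 'M[R]_(d, s))
    (u : 'cV[R]_d) (th : R) :
  std_gaussian_matrix P Om -> 0 < 1 + 2 * th * dot u u ->
  (\int[P]_w (expR (- th * dot ((Om w)^T *m u) ((Om w)^T *m u)))%:E =
   ((Num.sqrt (1 + 2 * th * dot u u))^-1 ^+ s)%:E)%E.
Proof.
move=> [mOm lawOm indepOm] h.
pose a (j : 'I_s) (ij : 'I_d * 'I_s) := if ij.2 == j then u ij.1 0 else 0.
pose X (ij : 'I_d * 'I_s) w := Om w ij.1 ij.2.
have iidX B : (forall ij, measurable (B ij)) ->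
    P (\bigcap_(ij in [set: 'I_d * 'I_s]) (X ij @^-1` B ij)) =
    (\prod_ij normal_prob 0 1 (B ij))%E.
  move=> mB; have := indepOm (fun i j => B (i, j)) (fun i j => mB (i, j)).
  rewrite (_ : \bigcap_(ij in _) _ = \bigcap_(ij in [set: 'I_d * 'I_s]) (X ij @^-1` B ij)).
    by move=> ->; apply: eq_bigr => -[i j] _; rewrite lawOm.
  by apply: eq_bigcapr => -[i j] _.
have sumE (F : 'I_d -> 'I_s -> R) j :
    \sum_(ij <- index_enum ('I_d * 'I_s)%type) (if ij.2 == j then F ij.1 ij.2 else 0) =
    \sum_i F i j.
  rewrite -(pair_big xpredT xpredT (fun i k => if k == j then F i k else 0)) /=.
  by apply: eq_bigr => i _; rewrite -big_mkcond big_pred1_eq.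
have S1 j : \sum_(ij <- index_enum ('I_d * 'I_s)%type) a j ij ^+ 2 = dot u u.
  rewrite dotE -(sumE (fun i _ => u i 0 * u i 0) j); apply: eq_bigr => ij _.
  by rewrite /a; case: ifP => _; rewrite ?expr2 ?mul0r.
have S2 j w : \sum_(ij <- index_enum ('I_d * 'I_s)%type) a j ij * X ij w =
    ((Om w)^T *m u) j 0.
  rewrite mxE -(sumE (fun i k => (Om w)^T k i * u i 0) j); apply: eq_bigr => ij _.
  by rewrite /a /X mxE; case: ifP => _; rewrite ?mul0r // mulrC.
have := @gaussian_family_integral _ T R P _ X (fun ij => mOm ij.1 ij.2) iidX s a
  (fun ij => ij.2) (index_enum ('I_d * 'I_s)%type) (fun=> th).
move=> E; under eq_integral.
  move=> w _; rewrite dotE mulr_sumr expR_sum.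
  under eq_bigr do rewrite -expr2 -S2.
  over.
rewrite E ?index_enum_uniq //.
- by under eq_bigr do rewrite S1; rewrite prodr_const card_ord.
- by move=> j ij; rewrite /a eq_sym => /negbTE ->.
- by move=> j; rewrite S1.
Qed.

(** * Elementary inequalities for the exponential and ln 2 *)

Section ElementaryBounds.
Variable R : realType.

Lemma expR_tangent (c x : R) : expR c * (1 + (x - c)) <= expR x.
Proof.
have := ler_wpM2l (expR_ge0 c) (expR_ge1Dx (x - c)).
by rewrite -expRD [c + _]addrC subrK.
Qed.

Lemma expR_convex2 (p q x y : R) : 0 <= p -> 0 <= q -> p + q = 1 ->
  expR (p * x + q * y) <= p * expR x + q * expR y.
Proof.
move=> p0 q0 pq; set c := p * x + q * y.
have h1 := ler_wpM2l p0 (expR_tangent c x).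
have h2 := ler_wpM2l q0 (expR_tangent c y).
apply: le_trans (lerD h1 h2).
have -> : p * (expR c * (1 + (x - c))) + q * (expR c * (1 + (y - c))) =
  expR c * ((p + q) * (1 - c) + c) by rewrite /c; ring.
by rewrite pq mul1r subrK mulr1.
Qed.

(** Jensen's inequality with the missing mass placed at the point 0, by summing tangent lines at the
    mean c. *)
Lemma expR_sub_convex (I : Type) (r : seq I) (wt x : I -> R) :
  (forall i, 0 <= wt i) -> \sum_(i <- r) wt i <= 1 ->
  expR (\sum_(i <- r) wt i * x i) <=
  \sum_(i <- r) wt i * expR (x i) + (1 - \sum_(i <- r) wt i).
Proof.
move=> w0 w1; set c := \sum_(i <- r) _.
have h : \sum_(i <- r) wt i * (expR c * (1 + (x i - c))) <=
    \sum_(i <- r) wt i * expR (x i).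
  by apply: ler_sum => i _; rewrite ler_wpM2l // expR_tangent.
have h1 : (1 - \sum_(i <- r) wt i) * (expR c * (1 + (0 - c))) <=
    1 - \sum_(i <- r) wt i.
  rewrite -[leRHS]mulr1 ler_wpM2l ?subr_ge0 // -[leRHS]expR0; exact: expR_tangent.
apply: le_trans (lerD h h1).
have -> : \sum_(i <- r) wt i * (expR c * (1 + (x i - c))) =
    expR c * ((1 - c) * \sum_(i <- r) wt i + c).
  rewrite (eq_bigr (fun i => expR c * (wt i * x i) + expR c * (1 - c) * wt i)).
    by rewrite big_split /= -!mulr_sumr -/c; ring.
  by move=> i _; ring.
lra.
Qed.

(** The logarithm of 1 + m is m - m^2 / 2 + O(m^3); taking 49/100 for 1/2 absorbs the remainder. On
    this range g increases up to 0 and decreases after it, with g 0 = 1. *)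
Lemma one_plus_le_expR (m : R) : `|m| <= 1 / 100 ->
  1 + m <= expR (m - 49 / 100 * m ^+ 2).
Proof.
move=> hm.
pose g (x : R) := (1 + x) * expR (49 / 100 * x ^+ 2 - x).
pose g' (x : R) := expR (49 / 100 * x ^+ 2 - x) * (x * (98 / 100 * x - 2 / 100)).
have dg (x : R) : is_derive x 1 g (g' x).
  rewrite /g /g'.
  apply: is_derive_eq.
  by rewrite /GRing.scale /=; move: (expR _) => e; field.
have gc : continuous g.
  by move=> x; apply/differentiable_continuous/derivable1_diffP.
suff h : g m <= 1.
  have := ler_wpM2r (expR_ge0 (m - 49 / 100 * m ^+ 2)) h.
  rewrite mul1r /g -[leLHS]mulrA -expRD (_ : 49 / 100 * m ^+ 2 - m + _ = 0).
    by rewrite expR0 mulr1.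
  by ring.
have g0 : g 0 = 1 by rewrite /g addr0 expr0n mulr0 subrr expR0 mulr1.
move: hm; rewrite ler_norml => /andP[m1 m2].
have [m0|m0] := leP 0 m.
  have [c] := @MVT_segment R g g' 0 m m0 (fun x _ => dg x) (continuous_subspaceT gc).
  rewrite in_itv /= => /andP[c0 cm] e.
  rewrite -g0 -subr_le0 e subr0 mulr_le0_ge0 // /g' mulr_ge0_le0 ?expR_ge0 //.
  by rewrite mulr_ge0_le0 //; lra.
have [c] := @MVT_segment R g g' m 0 (ltW m0) (fun x _ => dg x) (continuous_subspaceT gc).
rewrite in_itv /= => /andP[c0 cm] e.
rewrite -g0 -subr_ge0 e sub0r mulr_ge0 ?oppr_ge0 ?(ltW m0) // /g' mulr_ge0 ?expR_ge0 //.
by rewrite mulr_le0 //; lra.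
Qed.

(** Four times the right side is 1 + 3 (1 + z)^2, so this is a quadratic lower bound on its
    logarithm, tangent at z = 0. The proof goes through exp a <= 1 / (1 - a). *)
Lemma expR_le_quadratic (z : R) :
  expR (3 / 2 * z - 3 * z ^+ 2) <= 1 + 3 / 2 * z + 3 / 4 * z ^+ 2.
Proof.
set a := 3 / 2 * z - 3 * z ^+ 2.
have h := expR_ge1Dx (- a); rewrite expRN in h.
have sq := sqr_ge0 z.
have a1 : 0 < 1 - a by rewrite /a; nra.
have h2 : expR a <= (1 - a)^-1.
  by rewrite -[leLHS]invrK lef_pV2 ?posrE ?invr_gt0 ?expR_gt0.
apply: le_trans h2 _; rewrite -[leLHS]mul1r ler_pdivrMr //.
rewrite -subr_ge0.
have -> : (1 + 3 / 2 * z + 3 / 4 * z ^+ 2) * (1 - a) - 1 =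
  z ^+ 2 * (3 / 2 + 27 / 8 * z + 9 / 4 * z ^+ 2) by rewrite /a; field.
rewrite mulr_ge0 //; have := sqr_ge0 (z + 3 / 4); lra.
Qed.

Lemma ln2_ge : 69 / 100 <= ln (2 : R).
Proof.
rewrite -ler_expR lnK ?posrE //.
have h0 : 1 - 69 / (128 * 100) <= expR (- (69 / (128 * 100)) : R).
  by have := expR_ge1Dx (- (69 / (128 * 100)) : R); lra.
(* [1 - x <= expR (- x)] at [x = 0.69 / 128], then squared seven times, rounding
   down to fractions with small denominators. *)
have sq (x x' y : R) : 0 <= x -> x' <= x ^+ 2 -> x <= expR y -> x' <= expR (2 * y).
  move=> x0 xx' h; apply: le_trans xx' _.
  by rewrite -[2]/(1 + 1) mulrDl mul1r expRD expr2 ler_pM.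
have h1 : 92 / 93 <= @expR R (2 * (- (69 / (128 * 100)))) by apply: (sq _ _ _ _ _ h0); lra.
have h2 : 183 / 187 <= @expR R (2 * (2 * (- (69 / (128 * 100))))) by apply: (sq _ _ _ _ _ h1); lra.
have h3 : 181 / 189 <= @expR R (2 * (2 * (2 * (- (69 / (128 * 100)))))) by apply: (sq _ _ _ _ _ h2); lra.
have h4 : 653 / 712 <= @expR R (2 * (2 * (2 * (2 * (- (69 / (128 * 100))))))) by apply: (sq _ _ _ _ _ h3); lra.
have h5 : 593 / 705 <= @expR R (2 * (2 * (2 * (2 * (2 * (- (69 / (128 * 100)))))))) by apply: (sq _ _ _ _ _ h4); lra.
have h6 : 462 / 653 <= @expR R (2 * (2 * (2 * (2 * (2 * (2 * (- (69 / (128 * 100))))))))) by apply: (sq _ _ _ _ _ h5); lra.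
have h7 : 446 / 891 <= @expR R (2 * (2 * (2 * (2 * (2 * (2 * (2 * (- (69 / (128 * 100)))))))))) by apply: (sq _ _ _ _ _ h6); lra.
have e : expR (69 / 100 : R) * expR (2 * (2 * (2 * (2 * (2 * (2 * (2 * (- (69 / (128 * 100)))))))))) = 1.
  by rewrite -expRD -[RHS]expR0; congr expR; field.
have := ler_wpM2l (expR_ge0 (69 / 100 : R)) h7; rewrite e; lra.
Qed.

End ElementaryBounds.

(** * Rademacher signs and their tilts *)

Section RademacherTilt.
Variables (R : realType) (d : nat).
Implicit Types (b u v z : 'cV[R]_d) (bs : seq 'cV[R]_d).

(* The mean of [F (u + \sum_b e_b b)] over independent signs [e_b] of mean
   [dot b z]; at [z = 0] these are Rademacher signs. *)
Fixpoint tilt z bs (F : 'cV[R]_d -> R) u : R :=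
  if bs is b :: bs' then
    (1 + dot b z) / 2 * tilt z bs' F (u + b) +
    (1 - dot b z) / 2 * tilt z bs' F (u - b)
  else F u.

(** Keeps the tilted weights nonnegative and within the range of [one_plus_le_expR]. *)
Definition small z bs := forall b, b \in bs -> `|dot b z| <= 1 / 100.

Lemma small_cons z b bs : small z (b :: bs) -> `|dot b z| <= 1 / 100 /\ small z bs.
Proof.
move=> h; split; first by apply: h; rewrite mem_head.
by move=> c cb; apply: h; rewrite in_cons cb orbT.
Qed.

Lemma small_weights z b : `|dot b z| <= 1 / 100 ->
  0 <= (1 + dot b z) / 2 /\ 0 <= (1 - dot b z) / 2.
Proof. by rewrite ler_norml => /andP[h1 h2]; split; lra. Qed.

Lemma small0 bs : small 0 bs.
Proof. by move=> b _; rewrite dot0r normr0; lra. Qed.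

Lemma tilt_le z bs F G u : small z bs -> (forall v, F v <= G v) ->
  tilt z bs F u <= tilt z bs G u.
Proof.
move=> + FG; elim: bs u => [|b bs IH] u //= /small_cons [/small_weights [p q] sb].
by rewrite lerD // ler_wpM2l // IH.
Qed.

Lemma tiltD z bs F G u :
  tilt z bs (fun v => F v + G v) u = tilt z bs F u + tilt z bs G u.
Proof. by elim: bs u => [|b bs IH] u //=; rewrite !IH; ring. Qed.

Lemma tiltZ z bs c F u : tilt z bs (fun v => c * F v) u = c * tilt z bs F u.
Proof. by elim: bs u => [|b bs IH] u //=; rewrite !IH; ring. Qed.

Lemma tilt_cst z bs c u : tilt z bs (fun=> c) u = c.
Proof. by elim: bs u => [|b bs IH] u //=; rewrite !IH; field. Qed.

Lemma tilt_dot z bs v u :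
  tilt z bs (dot v) u = dot v (u + \sum_(b <- bs) dot b z *: b).
Proof.
elim: bs u => [|b bs IH] u /=; first by rewrite big_nil addr0.
by rewrite !IH big_cons !(dotDr, dotNr, dotZr); field.
Qed.

(** Squared mean plus variance: a sign of mean m has variance 1 - m^2, and independence removes
    cross terms. *)
Lemma tilt_sqr z bs n (A : 'M[R]_(n, d)) u :
  tilt z bs (fun v => dot (A *m v) (A *m v)) u =
  dot (A *m (u + \sum_(b <- bs) dot b z *: b)) (A *m (u + \sum_(b <- bs) dot b z *: b)) +
  \sum_(b <- bs) (1 - dot b z ^+ 2) * dot (A *m b) (A *m b).
Proof.
elim: bs u => [|b bs IH] u /=; first by rewrite !big_nil !addr0.
rewrite !IH !big_cons; set m := dot b z.
set v := \sum_(b <- bs) dot b z *: b; set r := \sum_(b <- bs) _.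
have e1 : A *m (u + b + v) = A *m (u + v) + A *m b by rewrite addrAC mulmxDr.
have e2 : A *m (u - b + v) = A *m (u + v) - A *m b by rewrite addrAC mulmxBr.
have e3 : A *m (u + (m *: b + v)) = A *m (u + v) + m *: (A *m b).
  by rewrite addrCA addrC mulmxDr scalemxAr.
rewrite e1 e2 e3 !(dotDl, dotDr, dotBl, dotBr, dotZl, dotZr, dotNl, dotNr).
by rewrite (dotC (A *m b) (A *m (u + v))); field.
Qed.

(* Gibbs' variational inequality: the relative entropy of the tilted signs is
   at most [51 / 100 * \sum_b dot b z ^+ 2]. *)
Lemma tilt_jensen z bs F u : small z bs ->
  expR (tilt z bs F u - 51 / 100 * \sum_(b <- bs) dot b z ^+ 2) <=
  tilt 0 bs (expR \o F) u.
Proof.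
elim: bs u => [|b bs IH] u /=; first by rewrite big_nil mulr0 subr0.
move=> /small_cons [hb sb]; have [p0 q0] := small_weights hb.
rewrite big_cons dot0r addr0 subr0; set m := dot b z in hb p0 q0 *.
set S := \sum_(b <- bs) _.
set A := tilt z bs F (u + b); set B := tilt z bs F (u - b).
have hA := IH (u + b) sb; have hB := IH (u - b) sb.
rewrite -/A -/S in hA; rewrite -/B -/S in hB.
set A' := A - _ in hA; set B' := B - _ in hB.
(* Change of measure for one sign: (1 + m') / 2 is at most exp (m' - 49/100 m'^2) times the fair
   weight 1 / 2. *)
have half (x y m' : R) : `|m'| <= 1 / 100 -> expR x <= y ->
    (1 + m') / 2 * expR (x - (m' - 49 / 100 * m' ^+ 2)) <= 1 / 2 * y.
  move=> hm' hxy; rewrite expRB mulrCA mulrA ler_pdivrMr ?expR_gt0 //.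
  have h1 := one_plus_le_expR hm'.
  have y0 : 0 <= y by apply: le_trans hxy; exact: expR_ge0.
  have h2 : expR x * (1 + m') <= y * expR (m' - 49 / 100 * m' ^+ 2).
    apply: ler_pM; rewrite ?expR_ge0 //.
    by move: hm'; rewrite ler_norml => /andP[h3 h4]; lra.
  lra.
have hA2 := half _ _ _ hb hA.
have hmb : `|- m| <= 1 / 100 by rewrite normrN.
have hB2 := half _ _ _ hmb hB.
apply: le_trans (lerD hA2 hB2).
(* The tilted average of the two exponents m - 49/100 m^2 and - m - 49/100 m^2 is 51/100 m^2. *)
have e : (1 + m) / 2 * A + (1 - m) / 2 * B - 51 / 100 * (m ^+ 2 + S) =
   (1 + m) / 2 * (A' - (m - 49 / 100 * m ^+ 2)) +
   (1 - m) / 2 * (B' - (- m - 49 / 100 * (- m) ^+ 2)).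
  by rewrite /A' /B'; field.
by rewrite e; apply: expR_convex2 => //; field.
Qed.

End RademacherTilt.

(** * Factorisation into short vectors *)

Section SmallFactorisation.
Variable R : realType.

(** Each b is replaced by N copies of b / sqrt N, which keeps the sum and divides each squared
    product with z by N. *)
Lemma psd_rank_one_sum_small n (K : 'M[R]_n) (N : nat) : psd K -> (0 < N)%N ->
  exists bs : seq 'cV[R]_n, K = \sum_(b <- bs) b *m b^T /\
    forall b z, b \in bs -> N%:R * dot b z ^+ 2 <= dot z (K *m z).
Proof.
move=> /psd_rank_one_sum [bs ->] N0.
have NR : 0 < N%:R :> R by rewrite ltr0n.
pose c := (Num.sqrt N%:R : R)^-1.
have c2 : c ^+ 2 = N%:R^-1 by rewrite exprVn sqr_sqrtr // ltW.
exists (flatten (nseq N [seq c *: b | b <- bs])); split=> [|b z].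
  rewrite big_flatten /= big_nseq iter_addr_0 big_map.
  rewrite [in RHS](eq_bigr (fun b => c ^+ 2 *: (b *m b^T))); last first.
    move=> b _; have -> : (c *: b)^T = c *: b^T by apply/matrixP => i j; rewrite !mxE.
    by rewrite -scalemxAl -scalemxAr scalerA expr2.
  by rewrite -scaler_sumr c2 -scaler_nat scalerA mulfV ?gt_eqF // scale1r.
move=> /flattenP [s /nseqP [-> _] /mapP [b' b'bs ->]].
rewrite dotZl exprMn c2 mulrA mulfV ?gt_eqF // mul1r sum_rank_one_dot.
rewrite (perm_big _ (perm_to_rem b'bs)) big_cons /= -expr2 lerDl.
by apply: sumr_ge0 => i _; rewrite -expr2 sqr_ge0.
Qed.

End SmallFactorisation.

(** For Gaussian [Om] the second factor is the reciprocal of the expectation of the first. *)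
Definition prior_kernel (R : realType) d s (th : R) (Om : 'M[R]_(d, s))
    (u : 'cV[R]_d) : R :=
  expR (- th * dot (Om^T *m u) (Om^T *m u)) *
  Num.sqrt (1 + 2 * th * dot u u) ^+ s.

(** * Expectations and tail bounds for a Gaussian sketch *)

Section Tails.
Context (dT : measure_display) (T : measurableType dT) (R : realType).
Variable P : probability T R.

Lemma markov_ge0 (g : T -> R) (a M : R) : 0 < a -> measurable_fun setT g ->
  (forall w, 0 <= g w) -> (\int[P]_w (g w)%:E <= M%:E)%E ->
  (P [set w | a <= g w]%R <= (M / a)%:E)%E.
Proof.
move=> a0 mg g0 hM.
have h : (a%:E * P (setT `&` [set w | a%:E <= `|(g w)%:E|]) <=
    \int[P]_w `|(g w)%:E|)%E.
  apply: (@le_integral_comp_abse _ T R P setT measurableT (EFin \o g) a idfun) => //.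
    exact: measurable_id.
  exact/measurable_EFinP.
rewrite EFinM lee_pdivlMr // muleC.
have -> : [set w | a <= g w] = setT `&` [set w | (a%:E <= `|(g w)%:E|)%E].
  by rewrite setTI; apply/seteqP; split=> w /=; rewrite lee_fin ger0_norm.
apply: le_trans h (le_trans _ hM).
by under eq_integral do rewrite /= ger0_norm //.
Qed.

Lemma measurable_superlevel (f : T -> R) (c : R) :
  measurable_fun setT f -> measurable [set w | c <= f w].
Proof.
move=> mf; rewrite -[X in measurable X]setTI.
rewrite (_ : [set w | _] = f @^-1` `[c, +oo[%classic); first exact: mf.
by apply/seteqP; split=> w /=; rewrite in_itv /= andbT.
Qed.

Section GaussianMatrix.
Variables (d s : nat) (Om : T -> 'M[R]_(d, s)).
Hypothesis hOm : std_gaussian_matrix P Om.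

Lemma measurable_gram (u : 'cV[R]_d) :
  measurable_fun setT (fun w => dot ((Om w)^T *m u) ((Om w)^T *m u)).
Proof.
have [mOm _ _] := hOm.
under eq_fun do rewrite dotE.
have mj j : measurable_fun setT (fun w => ((Om w)^T *m u) j 0).
  under eq_fun do rewrite mxE.
  apply: measurable_sum => i; under eq_fun do rewrite mxE.
  exact: measurable_funM.
by apply: measurable_sum => j; exact: measurable_funM.
Qed.

Lemma measurable_expR_gram th (u : 'cV[R]_d) :
  measurable_fun setT (fun w => expR (- th * dot ((Om w)^T *m u) ((Om w)^T *m u))).
Proof.
apply: measurableT_comp => //; apply: measurable_funM => //.
exact: measurable_gram.
Qed.

Lemma prior_kernel_integral th bs u : 0 <= th ->
  [/\ measurable_fun setT (fun w => tilt 0 bs (prior_kernel th (Om w)) u),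
      forall w, 0 <= tilt 0 bs (prior_kernel th (Om w)) u &
      (\int[P]_w (tilt 0 bs (prior_kernel th (Om w)) u)%:E = 1)%E].
Proof.
move=> th0; elim: bs u => [|b bs IH] u /=.
  have c0 : 0 < 1 + 2 * th * dot u u.
    by rewrite ltr_pwDl // mulr_ge0 ?dotxx_ge0 // mulr_ge0.
  have sq0 : 0 < Num.sqrt (1 + 2 * th * dot u u) by rewrite sqrtr_gt0.
  split.
  - by apply: measurable_funM => //; exact: measurable_expR_gram.
  - by move=> w; rewrite mulr_ge0 ?expR_ge0 // exprn_ge0 // sqrtr_ge0.
  rewrite /prior_kernel; under eq_integral do rewrite EFinM.
  rewrite ge0_integralZr //.
  - rewrite gaussian_matrix_mgf // -EFinM -exprMn mulVf ?expr1n //.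
    by rewrite gt_eqF.
  - by apply/measurable_EFinP; exact: measurable_expR_gram.
have [m1 p1 i1] := IH (u + b); have [m2 p2 i2] := IH (u - b).
rewrite dot0r addr0 subr0; split.
- by apply: measurable_funD; exact: measurable_funM.
- by move=> w; rewrite addr_ge0 // mulr_ge0.
have half (g : T -> R) : measurable_fun setT g -> (forall w, 0 <= g w) ->
    (\int[P]_w (g w)%:E = 1 -> \int[P]_w (1 / 2 * g w)%:E = (1 / 2)%:E)%E.
  move=> mg g0 ig; under eq_integral do rewrite EFinM.
  rewrite ge0_integralZl ?ig ?mule1 //; first exact/measurable_EFinP.
  by move=> w _; rewrite lee_fin.
under eq_integral do rewrite EFinD.
rewrite ge0_integralD ?half //=.
- by rewrite -EFinD; congr _%:E; field.
- by move=> w _; rewrite lee_fin mulr_ge0.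
- by apply/measurable_EFinP; exact: measurable_funM.
- by move=> w _; rewrite lee_fin mulr_ge0.
- by apply/measurable_EFinP; exact: measurable_funM.
Qed.

Lemma measurable_sum_gram (bs : seq 'cV[R]_d) :
  measurable_fun setT
    (fun w => \sum_(b <- bs) dot ((Om w)^T *m b) ((Om w)^T *m b)).
Proof. by apply: measurable_sum => b; exact: measurable_gram. Qed.

(* Convexity of [expR] with the weights [dot b b / D] reduces to one vector. *)
Lemma sum_gram_mgf (bs : seq 'cV[R]_d) (D q : R) :
  \sum_(b <- bs) dot b b <= D -> 0 < D -> 0 < q <= 1 ->
  (\int[P]_w (expR ((1 - q) / (2 * D) *
     \sum_(b <- bs) dot ((Om w)^T *m b) ((Om w)^T *m b)))%:E <=
   ((Num.sqrt q)^-1 ^+ s)%:E)%E.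
Proof.
move=> hD D0 /andP[q0 q1].
pose wt (b : 'cV[R]_d) := dot b b / D.
(* Chosen so that 1 + 2 th |b|^2 = q for b nonzero; the zero vector contributes the factor 1. *)
pose th (b : 'cV[R]_d) := - ((1 - q) / (2 * dot b b)).
have w0 b : 0 <= wt b by rewrite mulr_ge0 ?dotxx_ge0 // invr_ge0 ltW.
have w1 : \sum_(b <- bs) wt b <= 1 by rewrite -mulr_suml ler_pdivrMr // mul1r.
pose X w b := - th b * dot ((Om w)^T *m b) ((Om w)^T *m b).
have VE w : (1 - q) / (2 * D) * \sum_(b <- bs) dot ((Om w)^T *m b) ((Om w)^T *m b) =
    \sum_(b <- bs) wt b * X w b.
  rewrite mulr_sumr; apply: eq_bigr => b _; rewrite /wt /X /th.
  have [b0|b0] := eqVneq (dot b b) 0.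
    by rewrite (dotxx_eq0 b0) !mulmx0 !dot0r !(mulr0, mul0r).
  by field; rewrite b0 gt_eqF.
set M := _ ^+ s.
have sq1 : 1 <= (Num.sqrt q)^-1.
  by rewrite invf_ge1 ?sqrtr_gt0 // -sqrtr1 ler_wsqrtr.
have M1 : 1 <= M by rewrite exprn_ege1.
have mX b : measurable_fun setT (fun w => (expR (X w b))%:E).
  by apply/measurable_EFinP; exact: measurable_expR_gram.
have iX b : (\int[P]_w (expR (X w b))%:E <= M%:E)%E.
  have thE : 1 + 2 * th b * dot b b = if dot b b == 0 then 1 else q.
    rewrite /th; case: eqVneq => [->|b0]; first by rewrite mulr0 addr0.
    by field.
  rewrite gaussian_matrix_mgf //; last by rewrite thE; case: ifP.
  by rewrite thE lee_fin; case: ifP => // _; rewrite sqrtr1 invr1 expr1n.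
apply: (@le_trans _ _ (\int[P]_w (\sum_(b <- bs) ((wt b)%:E * (expR (X w b))%:E) +
    (1 - \sum_(b <- bs) wt b)%:E))%E).
  apply: ge0_le_integral => //.
  - apply/measurable_EFinP; apply: measurableT_comp => //.
    by apply: measurable_funM => //; exact: measurable_sum_gram.
  - apply: emeasurable_funD => //; apply: emeasurable_sum => b.
    exact: emeasurable_funM.
  - move=> w _; rewrite VE -(eq_bigr _ (fun b _ => EFinM _ _)) sumEFin -EFinD lee_fin.
    exact: expR_sub_convex.
rewrite ge0_integralD //=.
- rewrite ge0_integral_sum //=.
  + rewrite integral_cst // [X in (_ * X)%E](_ : _ = 1%E) ?mule1; last first.
      exact: probability_setT.
    apply: (@le_trans _ _ (\sum_(b <- bs) ((wt b)%:E * M%:E) +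
      (1 - \sum_(b <- bs) wt b)%:E)%E).
      rewrite leeD2r //; apply: lee_sum => b _.
      rewrite ge0_integralZl ?lee_fin //; apply: lee_wpmul2l (iX b).
      by rewrite lee_fin.
    rewrite -(eq_bigr _ (fun b _ => EFinM _ _)) sumEFin -EFinD lee_fin -mulr_suml.
    have : 0 <= (1 - \sum_(b <- bs) wt b) * (M - 1) by rewrite mulr_ge0 ?subr_ge0.
    lra.
  + by move=> b; exact: emeasurable_funM.
  + by move=> b w _; rewrite mule_ge0 ?lee_fin ?expR_ge0.
- by move=> w _; apply: sume_ge0 => b _; rewrite mule_ge0 ?lee_fin.
- by apply: emeasurable_sum => b; exact: emeasurable_funM.
- by move=> w _; rewrite lee_fin subr_ge0.
Qed.

(** Chernoff bound with q = (1 - h)^2. For y = 1 / (1 - h) the moment is y^s <= exp (s (y - 1)) and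
    the threshold contributes - s (y^2 - 1) / 2; the total is - s (y - 1)^2 / 2, and y - 1 >= h. *)
Lemma sum_gram_tail (bs : seq 'cV[R]_d) (D h : R) : 0 < D -> 0 <= h < 1 ->
  \sum_(b <- bs) dot b b <= D * (1 - h) ^+ 2 ->
  (P [set w | s%:R * D <= \sum_(b <- bs) dot ((Om w)^T *m b) ((Om w)^T *m b)]%R <=
   (expR (- (s%:R * h ^+ 2 / 2)))%:E)%E.
Proof.
move=> D0 /andP[h0 h1] hD; set q := (1 - h) ^+ 2 in hD.
have h10 : 0 < 1 - h by rewrite subr_gt0.
have q0 : 0 < q by rewrite exprn_gt0.
have q1 : q <= 1 by rewrite exprn_ile1 //; lra.
have Dq0 : 0 < D * q by rewrite mulr_gt0.
have hq : 0 < q <= 1 by rewrite q0.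
have hmgf := sum_gram_mgf hD Dq0 hq.
set eta := (1 - q) / (2 * (D * q)) in hmgf.
have eta0 : 0 <= eta by rewrite divr_ge0 ?subr_ge0 // mulr_ge0 // ltW.
pose V w := \sum_(b <- bs) dot ((Om w)^T *m b) ((Om w)^T *m b).
have sub : [set w | s%:R * D <= V w] `<=`
    [set w | expR (eta * (s%:R * D)) <= expR (eta * V w)].
  by move=> w /= hw; rewrite ler_expR ler_wpM2l.
have mE : measurable_fun setT (fun w => expR (eta * V w)).
  apply: measurableT_comp => //; apply: measurable_funM => //.
  exact: measurable_sum_gram.
apply: le_trans (le_measure P _ _ sub) _; rewrite ?inE.
- by apply: measurable_superlevel; exact: measurable_sum_gram.
- exact: measurable_superlevel.
apply: le_trans (markov_ge0 (expR_gt0 _) mE (fun w => expR_ge0 _) hmgf) _.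
rewrite lee_fin /q sqrtr_sqr ger0_norm ?(ltW h10) // -expRN.
pose y := (1 - h)^-1.
have y1 : h <= y - 1.
  rewrite /y lerBrDr -[leRHS]mul1r ler_pdivlMr //; nra.
have ye : y <= expR (y - 1) by have := expR_ge1Dx (y - 1); rewrite addrC subrK.
apply: (@le_trans _ _ (expR (y - 1) ^+ s * expR (- (eta * (s%:R * D))))).
  by rewrite ler_wpM2r ?expR_ge0 // lerXn2r ?nnegrE ?expR_ge0 // invr_ge0 ltW.
rewrite -expRM_natl -expRD ler_expR.
have -> : eta * (s%:R * D) = s%:R * ((y ^+ 2 - 1) / 2).
  rewrite /eta /y /q; field; rewrite ?gt_eqF //; lra.
have -> : s%:R * (y - 1) - s%:R * ((y ^+ 2 - 1) / 2) = - (s%:R * (y - 1) ^+ 2 / 2).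
  by field.
by rewrite lerN2 ler_wpM2r // ler_wpM2l // lerXn2r ?nnegrE // (le_trans h0).
Qed.

End GaussianMatrix.
End Tails.

(** * Directions annihilated by the sketch *)

Section Residual.
Variables (R : realType) (d s : nat) (H : 'M[R]_d) (sigma : R).
Hypotheses (pH : psd H) (sigma0 : 0 < sigma).
Let K := H *m invmx (H + sigma%:M).

Lemma deff_mx_le1 (x : 'cV[R]_d) : dot x (K *m x) <= dot x x.
Proof.
have E : x = (H + sigma%:M) *m (invmx (H + sigma%:M) *m x).
  by rewrite mulKVmx // shift_unitmx.
rewrite {2}E /K deff_mx_shift // {1 3 4}E; set y := invmx _ *m x.
rewrite mulmxDl mul_scalar_mx !(dotDl, dotDr, dotZl, dotZr).
have h1 := psd_dot y pH; have h2 := dotxx_ge0 y.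
rewrite [dot (H *m y) y]dotC.
have : 0 <= sigma * dot y (H *m y) by rewrite mulr_ge0 // ltW.
have : 0 <= sigma * (sigma * dot y y) by rewrite !mulr_ge0 // ltW.
lra.
Qed.

(** Let y be the residual vector of x, e = y^T H y and z = (H + sigma) y, so that u = H y.
    Cauchy-Schwarz gives e^2 <= |x|^2 |u|^2, hence 6 sigma e <= |u|^2, while z^T u = |u|^2 + sigma
    e. *)
Lemma residual_direction (Om : 'M[R]_(d, s)) x :
  6 * sigma * dot x x < dot x ((H - nystrom H Om) *m x) ->
  exists z, let u := K *m z in
    [/\ Om^T *m u = 0, 0 < dot u u & dot z u <= 7 / 6 * dot u u].
Proof.
move=> hx; have [y [Ey Oy xE]] := nystrom_residual Om x pH.
exists ((H + sigma%:M) *m y); rewrite /= /K deff_mx_shift //.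
rewrite xE in hx; set e := dot y (H *m y) in hx xE *.
have x0 := dotxx_ge0 x.
have e0 : 0 < e by apply: le_lt_trans hx; rewrite !mulr_ge0 // ltW.
have cs := cauchy_schwarz x (H *m y); rewrite -Ey xE Ey in cs.
set q := dot (H *m y) (H *m y) in cs *.
have q0 : 0 <= q by exact: dotxx_ge0.
have h : 6 * sigma * e <= q.
  rewrite -(ler_pM2r e0).
  have : 6 * sigma * e ^+ 2 <= 6 * sigma * (dot x x * q).
    by rewrite ler_wpM2l // mulr_ge0 // ltW.
  have : 6 * sigma * dot x x * q <= e * q by rewrite ler_wpM2r // ltW.
  lra.
have se : 0 < sigma * e by rewrite mulr_gt0.
split=> //; first by lra.
by rewrite mulmxDl mul_scalar_mx dotDl dotZl -/e -/q; lra.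
Qed.

(* Tilting the Rademacher prior towards [u := K z], which [Om^T] kills: on the
   tilted signs [dot u v / dot u u] has mean [1] and variance at most
   [1 / dot u u], so [prior_kernel] is large there. *)
Lemma prior_kernel_ge (Om : 'M[R]_(d, s)) bs z :
  K = \sum_(b <- bs) b *m b^T -> small z bs ->
  let u := K *m z in let L := dot u u in
  Om^T *m u = 0 -> 0 < L -> dot z u <= 7 / 6 * L ->
  expR (s%:R * ln 2
        - 3 / (2 * L) * \sum_(b <- bs) dot (Om^T *m b) (Om^T *m b)
        - 3 / 2 * s%:R / L - 51 / 100 * (7 / 6 * L)) <=
  tilt 0 bs (prior_kernel (3 / (2 * L)) Om) 0.
Proof.
move=> KE sm u L Ou L0 hz.
set V := \sum_(b <- bs) _; set th := 3 / (2 * L).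
have th0 : 0 <= th by rewrite divr_ge0 // mulr_ge0 // ltW.
(* A lower bound for the logarithm of [prior_kernel], quadratic so that its tilted mean is explicit.
   With y = u^T v / L - 1, Cauchy-Schwarz gives 2 th |v|^2 >= 3 (1 + y)^2, and [expR_le_quadratic]
   yields s (ln 2 + (3/2 y - 3 y^2) / 2), expanded here in u^T v. *)
pose F v := - th * dot (Om^T *m v) (Om^T *m v) +
  ((s%:R * ln 2 - 9 / 4 * s%:R) + (15 / 4 * s%:R / L * dot u v +
    - (3 / 2 * s%:R / L ^+ 2) * dot (u^T *m v) (u^T *m v))).
have uu v : dot (u^T *m v) (u^T *m v) = dot u v ^+ 2 by rewrite dotE big_ord1 -expr2.
have FW v : expR (F v) <= prior_kernel th Om v.
  rewrite /F /prior_kernel expRD ler_wpM2l ?expR_ge0 // uu.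
  pose y := dot u v / L - 1.
  have -> : s%:R * ln 2 - 9 / 4 * s%:R + (15 / 4 * s%:R / L * dot u v +
      - (3 / 2 * s%:R / L ^+ 2) * dot u v ^+ 2) =
      s%:R * (ln 2 + (3 / 2 * y - 3 * y ^+ 2) / 2).
    by rewrite /y; field; rewrite gt_eqF.
  rewrite expRM_natl lerXn2r ?nnegrE ?expR_ge0 ?sqrtr_ge0 //.
  rewrite -[leLHS]ger0_norm ?expR_ge0 // -sqrtr_sqr; apply: ler_wsqrtr.
  set a := 3 / 2 * y - 3 * y ^+ 2.
  have ea : expR (a / 2) ^+ 2 = expR a by rewrite -expRM_natl; congr expR; field.
  rewrite expRD lnK ?posrE // exprMn ea.
  have h1 := expR_le_quadratic y; rewrite -/a in h1.
  have h2 : (1 + y) ^+ 2 <= dot v v / L.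
    have -> : 1 + y = dot u v / L by rewrite addrC subrK.
    rewrite expr_div_n ler_pdivrMr ?exprn_gt0 //.
    have := cauchy_schwarz u v; rewrite -/L => /le_trans; apply.
    by rewrite expr2 mulrA divfK ?gt_eqF // mulrC.
  have -> : 2 * th * dot v v = 3 * (dot v v / L) by rewrite /th; field; rewrite gt_eqF.
  lra.
apply: le_trans (tilt_le 0 (@small0 R d bs) FW).
apply: le_trans (tilt_jensen F 0 sm); rewrite ler_expR.
have Kz : \sum_(b <- bs) dot b z *: b = u.
  rewrite /u KE mulmx_suml; apply: eq_bigr => b _.
  by rewrite rank_one_dot.
have mm : \sum_(b <- bs) dot b z ^+ 2 = dot z u.
  rewrite /u KE sum_rank_one_dot.
  by apply: eq_bigr => b _; rewrite expr2.
rewrite mm /F !tiltD !tiltZ !tilt_cst tilt_dot !tilt_sqr Kz add0r Ou dot0r add0r.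
rewrite -/L uu -/L.
have t1 : \sum_(b <- bs) (1 - dot b z ^+ 2) * dot (Om^T *m b) (Om^T *m b) <= V.
  rewrite big_seq /V [leRHS]big_seq; apply: ler_sum => b bb.
  by rewrite ler_piMl ?dotxx_ge0 // lerBlDr lerDl sqr_ge0.
(* The variance of u^T v is at most u^T K u <= |u|^2. *)
have t2 : \sum_(b <- bs) (1 - dot b z ^+ 2) * dot (u^T *m b) (u^T *m b) <= L.
  apply: le_trans (deff_mx_le1 u); rewrite KE sum_rank_one_dot.
  apply: ler_sum => b _; rewrite uu (dotC u b) -expr2.
  by rewrite ler_piMl ?sqr_ge0 // lerBlDr lerDl sqr_ge0.
set A := \sum_(b <- bs) _ in t1 *; set B := \sum_(b <- bs) _ in t2 *.
have h1 := ler_wpM2l th0 t1.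
have c0 : 0 <= 3 / 2 * s%:R / L ^+ 2 by rewrite divr_ge0 ?sqr_ge0 // mulr_ge0.
have h2 := ler_wpM2l c0 t2.
have e1 : 15 / 4 * s%:R / L * L = 15 / 4 * s%:R :> R by rewrite divfK ?gt_eqF.
have e2 : 3 / 2 * s%:R / L ^+ 2 * L ^+ 2 = 3 / 2 * s%:R :> R.
  by rewrite divfK ?gt_eqF ?exprn_gt0.
have e3 : 3 / 2 * s%:R / L ^+ 2 * L = 3 / 2 * s%:R / L :> R.
  by field; rewrite gt_eqF.
rewrite e3 in h2; rewrite e1 mulrDr.
have e4 : - (3 / 2 * s%:R / L ^+ 2) * L ^+ 2 = - (3 / 2 * s%:R) by rewrite mulNr e2.
by rewrite e4 mulNr mulNr; lra.
Qed.

End Residual.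

(** * Choice of constants and the good event *)

Section Assembly.
Variables (R : realType) (d s : nat) (H : 'M[R]_d) (sigma delta : R).
Hypotheses (pH : psd H) (sigma0 : 0 < sigma) (hdelta : 0 < delta < 1).
Hypothesis hs :
  8 * (Num.sqrt (deff H sigma) + Num.sqrt (8 * ln (16 / delta))) ^+ 2 <= s%:R.

Let l := ln (16 / delta).
(** The squared length given to u. The factor 4/7 nearly minimises 3 V / (2 L) + 51/100 (7/6 L) at V
    = s^2 / 8. *)
Let L : R := 4 / 7 * s%:R.

Lemma log_ge : 4 * (69 / 100) <= l.
Proof.
have /andP[d0 d1] := hdelta.
have h : 4 * (69 / 100) <= ln (16 : R).
  have -> : (16 : R) = 2 ^+ 4 by ring.
  by rewrite lnXn // -[ln 2 *+ 4]mulr_natl; have := ln2_ge R; lra.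
apply: le_trans h _; rewrite ler_ln ?posrE ?divr_gt0 //.
by rewrite ler_pdivlMr // ler_piMr // ltW.
Qed.

Lemma deff_ge0 : 0 <= deff H sigma.
Proof.
have [bs hbs] := psd_rank_one_sum (psd_deff_mx pH sigma0).
by rewrite /deff hbs sum_rank_one_tr; apply: sumr_ge0 => b _; exact: dotxx_ge0.
Qed.

Lemma sketch_size_ge_log : 64 * l <= s%:R.
Proof.
have l0 : 0 <= 8 * l by have := log_ge; lra.
have a0 := sqrtr_ge0 (deff H sigma); have t0 := sqrtr_ge0 (8 * l).
have t2 := sqr_sqrtr l0.
apply: le_trans hs; rewrite -/l.
move: (Num.sqrt _) (Num.sqrt (8 * l)) a0 t0 t2 => a t a0 t0 t2.
have : 0 <= a * (a + 2 * t) by rewrite mulr_ge0 // addr_ge0 // mulr_ge0.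
by lra.
Qed.

Lemma sketch_size_ge_deff : 8 * deff H sigma <= s%:R.
Proof.
have a0 := sqrtr_ge0 (deff H sigma); have t0 := sqrtr_ge0 (8 * l).
have a2 := sqr_sqrtr deff_ge0.
apply: le_trans hs; rewrite -/l -{1}a2.
move: (Num.sqrt _) (Num.sqrt (8 * l)) a0 t0 {a2} => a t a0 t0.
have : 0 <= t * (t + 2 * a) by rewrite mulr_ge0 // addr_ge0 // mulr_ge0.
by lra.
Qed.

Lemma sketch_size_gt0 : 0 < s%:R :> R.
Proof. by have := sketch_size_ge_log; have := log_ge; lra. Qed.

Lemma residual_le (Om : 'M[R]_(d, s)) bs :
  H *m invmx (H + sigma%:M) = \sum_(b <- bs) b *m b^T ->
  (forall b z, b \in bs -> (100 * 100 * s)%N%:R * dot b z ^+ 2 <=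
    dot z (H *m invmx (H + sigma%:M) *m z)) ->
  tilt 0 bs (prior_kernel (3 / (2 * L)) Om) 0 < 2 / delta ->
  \sum_(b <- bs) dot (Om^T *m b) (Om^T *m b) < s%:R * (s%:R / 8) ->
  forall x, dot x ((H - nystrom H Om) *m x) <= 6 * sigma * dot x x.
Proof.
move=> KE hN hW hV x; rewrite leNgt; apply/negP.
move=> /(residual_direction pH sigma0) [z0 /= [Oz0 u00 hz0]].
have s0 := sketch_size_gt0.
have L0 : 0 < L by rewrite mulr_gt0.
set K := H *m _ in KE hN Oz0 u00 hz0 *.
set u0 := K *m z0 in Oz0 u00 hz0 *.
(* The properties of the direction are homogeneous, so it may be scaled to |u|^2 = L. *)
pose c := Num.sqrt (L / dot u0 u0).
have c2 : c ^+ 2 = L / dot u0 u0 by rewrite sqr_sqrtr // divr_ge0 // ltW.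
pose z := c *: z0.
have Kz : K *m z = c *: u0 by rewrite /z -scalemxAr.
have LE : dot (K *m z) (K *m z) = L.
  by rewrite Kz dotZl dotZr mulrA -expr2 c2 divfK ?gt_eqF.
have hz : dot z (K *m z) <= 7 / 6 * L.
  rewrite Kz /z dotZl dotZr mulrA -expr2.
  have -> : 7 / 6 * L = c ^+ 2 * (7 / 6 * dot u0 u0).
    by rewrite c2; field; rewrite gt_eqF.
  by rewrite ler_wpM2l // sqr_ge0.
(* The squared product of b and z is at most (7/6) L / (10^4 s) = (2/3) / 10^4, whence the factor
   100 * 100 * s. *)
have sm : small z bs.
  move=> b bb; have c100 : 0 <= 1 / 100 :> R by lra.
  rewrite -ler_sqr ?nnegrE // real_normK ?num_real //.
  have := le_trans (hN b z bb) hz; rewrite !natrM /L => h.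
  rewrite -(ler_pM2l s0).
  have : 0 <= s%:R * dot b z ^+ 2 by rewrite mulr_ge0 ?sqr_ge0 // ltW.
  by move: h; move: (s%:R : R) s0 (dot b z ^+ 2) => S S0 q; lra.
have Oz : Om^T *m (K *m z) = 0 by rewrite Kz -scalemxAr Oz0 scaler0.
have := prior_kernel_ge pH sigma0 KE sm; rewrite /= LE => /(_ _ Om Oz L0 hz).
rewrite leNgt => /negP; apply; apply: lt_le_trans hW _.
have /andP[d0 d1] := hdelta.
have e2 : 2 / delta = expR (l - 3 * ln 2).
  rewrite expRB lnK ?posrE ?divr_gt0 // -[3]/(3%:R) expRM_natl lnK ?posrE //.
  by field; rewrite gt_eqF.
rewrite e2 ler_expR.
have h1 := sketch_size_ge_log; have h2 := log_ge; have h3 := ln2_ge R.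
set V := \sum_(b <- bs) _ in hV *.
have t1 : 3 / (2 * L) * V <= 21 / 64 * s%:R.
  have -> : 21 / 64 * s%:R = 3 / (2 * L) * (s%:R * (s%:R / 8)).
    by rewrite /L; field; rewrite gt_eqF.
  by rewrite ler_wpM2l ?(ltW hV) // divr_ge0 // mulr_ge0 // ltW.
have t2 : 3 / 2 * s%:R / L = 21 / 8 by rewrite /L; field; rewrite gt_eqF.
rewrite t2; move: (3 / (2 * L) * V) t1 => X t1; rewrite /L.
(* Per unit of s the exponent gains 69/100 - 21/64 - 34/100 > 21/1000. As s >= 64 l this exceeds 1.3
   l, which covers l - 3 ln 2 + 21/8 because l >= 2.76. *)
have t3 : (s%:R : R) * (69 / 100) <= s%:R * ln 2 by rewrite ler_wpM2l // ltW.
lra.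
Qed.

Lemma good_event (dT : measure_display) (T : measurableType dT)
    (P : probability T R) (Om : T -> 'M[R]_(d, s)) : std_gaussian_matrix P Om ->
  exists A : set T, [/\ measurable A, ((1 - delta)%:E <= P A)%E &
    forall w, A w -> forall x,
      dot x ((H - nystrom H (Om w)) *m x) <= 6 * sigma * dot x x].
Proof.
move=> hOm; have s0 := sketch_size_gt0; have /andP[d0 d1] := hdelta.
have sN : (0 < s)%N by rewrite ltr0n in s0.
have [|bs [KE hN]] := psd_rank_one_sum_small (N := 100 * 100 * s) (psd_deff_mx pH sigma0).
  by rewrite muln_gt0 sN.
have th0 : 0 <= 3 / (2 * L) by rewrite divr_ge0 // !mulr_ge0 // ltW.
have [mW W0 iW] := prior_kernel_integral hOm bs 0 th0.
set W := fun w => _ in mW; pose V w := \sum_(b <- bs) dot ((Om w)^T *m b) ((Om w)^T *m b).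
have mV : measurable_fun setT V := measurable_sum_gram hOm bs.
pose B1 := [set w | 2 / delta <= W w]; pose B2 := [set w | s%:R * (s%:R / 8) <= V w].
have mB1 : measurable B1 by exact: measurable_superlevel.
have mB2 : measurable B2 by exact: measurable_superlevel.
have mB : measurable (B1 `|` B2) by exact: measurableU.
exists (~` (B1 `|` B2)); split.
- exact: measurableC.
- have P1 : (P B1 <= (delta / 2)%:E)%E.
    have := @markov_ge0 _ _ _ P W (2 / delta) 1 _ mW W0 _.
    by rewrite invf_div mul1r; apply; rewrite ?divr_gt0 // iW.
  have P2 : (P B2 <= (delta / 2)%:E)%E.
    pose r := Num.sqrt (s%:R / 8 : R); pose t := Num.sqrt (8 * l).
    have l0 := log_ge; have l80 : 0 <= 8 * l by lra.
    have t0 : 0 <= t by exact: sqrtr_ge0.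
    have a0 := sqrtr_ge0 (deff H sigma).
    have r2 : r ^+ 2 = s%:R / 8 by rewrite sqr_sqrtr // divr_ge0 // ltW.
    have r0 : 0 < r by rewrite sqrtr_gt0 divr_gt0.
    have t2 : t ^+ 2 = 8 * l by rewrite sqr_sqrtr.
    have art : Num.sqrt (deff H sigma) + t <= r.
      by rewrite -ler_sqr ?nnegrE ?addr_ge0 ?sqrtr_ge0 // r2 ler_pdivlMr // mulrC.
    (* Half of the slack t is spent: r (1 - h) = r - t / 2 still dominates the root of deff, h stays
       below 1, and the exponent s h^2 / 2 equals 8 l. *)
    pose h := t / (2 * r).
    have rh : r * (1 - h) = r - t / 2 by rewrite /h; field; rewrite gt_eqF.
    have h0 : 0 <= h by rewrite divr_ge0 // mulr_ge0 // ltW.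
    have h1 : h < 1 by rewrite ltr_pdivrMr ?mulr_gt0 //; lra.
    have hD : \sum_(b <- bs) dot b b <= s%:R / 8 * (1 - h) ^+ 2.
      rewrite -sum_rank_one_tr -KE -/(deff H sigma) -r2 -exprMn rh.
      by rewrite -[leLHS](sqr_sqrtr deff_ge0) ler_sqr ?nnegrE; lra.
    have D0 : 0 < s%:R / 8 :> R by rewrite divr_gt0.
    have hh : 0 <= h < 1 by rewrite h0.
    apply: le_trans (sum_gram_tail hOm D0 hh hD) _; rewrite lee_fin.
    have -> : s%:R * h ^+ 2 / 2 = 8 * l.
      rewrite /h expr_div_n t2 exprMn r2; field.
      by rewrite pnatr_eq0 -lt0n.
    apply: (@le_trans _ _ (expR (- l))); first by rewrite ler_expR; lra.
    by rewrite expRN lnK ?posrE ?divr_gt0 // invf_div; lra.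
  rewrite probability_setC // EFinB; apply: leeB => //.
  apply: le_trans (measureU2 _ mB1 mB2) _.
  by apply: le_trans (leeD P1 P2) _; rewrite -EFinD lee_fin; lra.
- move=> w /= hw; have [n1 n2] : ~ B1 w /\ ~ B2 w by split=> h; apply: hw; [left|right].
  apply: (residual_le KE hN); rewrite ltNge; apply/negP; [exact: n1|exact: n2].
Qed.

End Assembly.


Theorem theorem4p4 (R : realType) (d s : nat) (H : 'M[R]_d) (rho delta eps : R)
    (dT : measure_display) (T : measurableType dT) (P : probability T R)
    (Omega : T -> 'M[R]_(d, s)) (U : T -> 'M[R]_(d, s)) (lam : T -> 'rV[R]_s) :
  psd H -> 0 < rho -> 0 < delta < 1 -> 0 < eps ->
  (s <= d)%N ->
  std_gaussian_matrix P Omega ->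
  (forall w, nystrom_eig H (Omega w) (U w) (lam w)) ->
  8 * (Num.sqrt (deff H (eps * rho / 6)) + Num.sqrt (8 * ln (16 / delta))) ^+ 2
    <= s%:R ->
  (forall w, (lamhat_s (lam w) + rho) / rho <= 1 + eps / 42) /\
  exists A : set T, [/\ measurable A,
    A `<=` [set w | `| kappa2 (inv_sqrtm (nystrom_precond (U w) (lam w) rho)
                              *m (H + rho%:M)
                              *m inv_sqrtm (nystrom_precond (U w) (lam w) rho))
                       - (lamhat_s (lam w) + rho) / rho | <= eps] &
    ((1 - delta)%:E <= P A)%E].
Proof.
move=> pH rho0 hdelta eps0 sd hOm hE hs.
have sigma0 : 0 < eps * rho / 6 by rewrite divr_gt0 // mulr_gt0.
have sN : (0 < s)%N by rewrite -(ltr0n R) (sketch_size_gt0 hdelta hs).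
have hls w : lamhat_s (lam w) <= eps * rho / 6 / 7.
  apply: (lamhat_le pH sigma0 sN (hE w)).
  exact: (sketch_size_ge_deff pH sigma0 hs).
have hemp w : (lamhat_s (lam w) + rho) / rho <= 1 + eps / 42.
  by rewrite ler_pdivrMr //; have := hls w; lra.
split=> //.
have [A [mA PA hA]] := good_event pH sigma0 hdelta hs hOm.
exists A; split=> // w Aw /=.
have eta0 : 0 <= eps * rho by rewrite mulr_ge0 // ltW.
have hx x : dot x ((H - nystrom H (Omega w)) *m x) <= eps * rho * dot x x.
  by have := hA w Aw x; rewrite mulrCA mulfV ?mulr1.
have /andP[k1 k2] := kappa2_precond pH rho0 eta0 sN sd (hE w) hx.
rewrite mulrDl mulfK ?gt_eqF // in k2.
(* From above, [k2] is the empirical condition number plus eps. From below, kappa is at least 1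
   while the empirical number is at most 1 + eps / 42. *)
by rewrite ler_norml; apply/andP; split; have := hemp w; lra.
Qed.
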